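(* Let $F$ and $G$ be locally analytic maps fixing the origin of $K^2$, both of the form $$(x,y)\mapsto(\lambda_1 x+O(2),\ \lambda_2 y+O(2))$$ with the same eigenvalues $\lambda_1,\lambda_2\in K\setminus\{0\}$. Suppose that either of the following holds: (1) (Attracting/Repelling Case) $\lambda_2=\lambda_1^n$ for some integer $n\ge 2$, and $|\lambda_i|\ne 1$ for $i=1,2$; (2) (Semihyperbolic Case) $\lambda_1=1$ and $|\lambda_2|\neq 1$. Then $F$ and $G$ are formally equivalent if and only if they are analytically equivalent.
   Context: $K$ is a complete, nontrivially valued non-archimedean field of characteristic $0$ with norm $|\cdot|$. A formal map of $K^2$ fixing $0$ is a pair of power series in $K[[x,y]]$ with zero constant term; it is analytic (at $0$) if both series converge on some polydisc containing $0$. $O(2)$ denotes a power series all of whose terms have total degree at least $2$. Two maps $F,G$ fixing $0$ are formally equivalent if there is a formal map $\Phi$ fixing $0$, invertible under composition, with $\Phi\circ F\circ\Phi^{-1}=G$ as formal power series; they are analytically equivalent if such a $\Phi$ exists which is moreover analytic at $0$ (with analytic inverse). *)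

(* Defs.v *)
From mathcomp Require Import all_boot all_order all_algebra finmap.
From mathcomp Require Import all_classical all_reals topology normedtype.
From mathcomp Require Import summability.

Set Implicit Arguments.
Unset Strict Implicit.
Unset Printing Implicit Defensive.

Import Order.TTheory GRing.Theory Num.Theory.
Import numFieldNormedType.Exports.

Local Open Scope classical_set_scope.
Local Open Scope ring_scope.

Record nonarch_norm (R : realType) (K : fieldType) := NonArchNorm {
  nanorm :> K -> R;
  nanorm_ge0 : forall x, 0 <= nanorm x;
  nanorm_eq0 : forall x, (nanorm x == 0) = (x == 0);
  nanormM : forall x y, nanorm (x * y) = nanorm x * nanorm y;
  nanormD : forall x y, nanorm (x + y) <= Num.max (nanorm x) (nanorm y)
}.

Section NonArch.
Context {R : realType} {K : fieldType}.
Variable v : nonarch_norm R K.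

Definition nontrivial_norm := exists x : K, x != 0 /\ v x != 1.

Definition na_cauchy (u : nat -> K) :=
  forall e : R, 0 < e -> \forall m & n \near \oo, v (u m - u n) < e.

Definition na_cvg_to (u : nat -> K) (l : K) :=
  v (u n - l) @[n --> \oo] --> (0 : R).

Definition complete_norm :=
  forall u : nat -> K, na_cauchy u -> exists l : K, na_cvg_to u l.

End NonArch.

(* [f : fps2 K] is the power series \sum_(i, j) f i j x^i y^j in K[[x, y]]. *)
Definition fps2 (K : fieldType) := nat -> nat -> K.

Section FormalMaps.
Context {K : fieldType}.
Implicit Types (f g : fps2 K).

Definition fps2_one : fps2 K := fun i j => ((i == 0%N) && (j == 0%N))%:R.
Definition fps2_x : fps2 K := fun i j => ((i == 1%N) && (j == 0%N))%:R.
Definition fps2_y : fps2 K := fun i j => ((i == 0%N) && (j == 1%N))%:R.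

Definition fps2_mul f g : fps2 K := fun i j =>
  \sum_(k < i.+1) \sum_(l < j.+1) f k l * g (i - k)%N (j - l)%N.

Definition fps2_exp f (n : nat) : fps2 K := iter n (fps2_mul f) fps2_one.

Definition fmap2 := (fps2 K * fps2 K)%type.

Definition fixes_origin (F : fmap2) := F.1 0%N 0%N = 0 /\ F.2 0%N 0%N = 0.

(* Substitution f(P.1, P.2), for [P] fixing the origin: then P.1^k P.2^l only
   has terms of degree at least k + l, so the terms of f of degree larger than
   i + j do not contribute to the coefficient of x^i y^j. *)
Definition fps2_comp f (P : fmap2) : fps2 K := fun i j =>
  \sum_(k < (i + j).+1) \sum_(l < (i + j).+1)
    f k l * fps2_mul (fps2_exp P.1 k) (fps2_exp P.2 l) i j.

Definition fmap2_id : fmap2 := (fps2_x, fps2_y).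

Definition fmap2_comp (F P : fmap2) : fmap2 :=
  (fps2_comp F.1 P, fps2_comp F.2 P).

Definition is_O2 f := forall i j : nat, (i + j < 2)%N -> f i j = 0.

Definition has_diagonal_linear_part (l1 l2 : K) (F : fmap2) :=
  is_O2 (fun i j => F.1 i j - l1 * fps2_x i j) /\
  is_O2 (fun i j => F.2 i j - l2 * fps2_y i j).

Definition inverse_fmap2 (P Q : fmap2) :=
  fmap2_comp P Q = fmap2_id /\ fmap2_comp Q P = fmap2_id.

Definition formally_equivalent (F G : fmap2) :=
  exists P Q : fmap2,
    [/\ fixes_origin P, fixes_origin Q, inverse_fmap2 P Q
      & fmap2_comp (fmap2_comp P F) Q = G].

End FormalMaps.

Arguments fmap2 K : clear implicits.

Section AnalyticMaps.
Context {R : realType} {K : fieldType}.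
Variable v : nonarch_norm R K.

(* Convergence of the double series f(x, y): the sums over finite sets of
   indices converge along the directed set of all finite sets of indices. *)
Definition fps2_cvg_at (f : fps2 K) (x y : K) := exists s : K,
  v (partial_sum (fun p : nat * nat => f p.1 p.2 * x ^+ p.1 * y ^+ p.2) A - s)
    @[A --> totally] --> (0 : R).

Definition cvg_on_polydisc (r1 r2 : R) (f : fps2 K) :=
  forall x y : K, v x <= r1 -> v y <= r2 -> fps2_cvg_at f x y.

Definition analytic_fmap2 (F : fmap2 K) :=
  exists r1 r2 : R, [/\ 0 < r1, 0 < r2,
    cvg_on_polydisc r1 r2 F.1 & cvg_on_polydisc r1 r2 F.2].

Definition analytically_equivalent (F G : fmap2 K) :=
  exists P Q : fmap2 K,
    [/\ fixes_origin P /\ fixes_origin Q, inverse_fmap2 P Q,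
        analytic_fmap2 P, analytic_fmap2 Q
      & fmap2_comp (fmap2_comp P F) Q = G].

End AnalyticMaps.

(* Main.v *)
From HB Require Import structures.
Require Import Defs.
From mathcomp Require Import all_boot all_order all_algebra finmap.
From mathcomp Require Import all_classical all_reals topology normedtype.
From mathcomp Require Import sequences summability.
From mathcomp Require Import ring lra zify.
(** Over a non-archimedean field an analytic series is one whose coefficients
    grow at most geometrically, and every estimate below bears on coefficients:
    a conjugacy equation is solved degree by degree, and the ultrametric
    inequality turns bounds on the coefficients of lower degree into a bound on
    the next one. The only obstruction is the size of the divisors.

    After replacing both maps by their inverses if needed, the eigenvalues are
    [t ^+ a] and [t ^+ b] with norm of [t] less than 1, and weights [(a, b)] equal to
    [(1, n)] in the resonant attracting case and to [(0, 1)] in the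
    semihyperbolic case. Give [x] and [y] the weights [a] and [b]. A term
    of weight [m] in the component of weight [w] is resonant when [m = w];
    otherwise its divisor [t ^+ w - t ^+ m] is a difference of two numbers of
    distinct norms and is bounded below. Hence there are no small divisors, and
    each map is analytically conjugate to a normal form made of resonant terms only
    ([analytic_normal_form]). A formal conjugacy between two
    normal forms is itself made of resonant terms ([conj_normal_forms_homog]).

    In the attracting case such a conjugacy is a polynomial map.

    In the semihyperbolic case the normal forms are [(f x, y * m x)] and
    [(g x, y * n x)], where [f] and [g] are tangent to the identity, and the
    conjugacy is [(p x, y * q x)]. If [f] is the identity, so is [g], and the
    conjugacy amounts to [m = n \o p]: either [m] is constant and the normal forms
    are equal, or [p] is analytic and [(p x, y)] is another conjugacy
    ([semihyperbolic_curve]). If [f] is not the identity, with first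
    term [al * x ^+ k.+1] after [x], then the recursions satisfied by the
    coefficients of [p] and [q] have divisors [al * (k - n)] and [t * al * n]
    ([semihyperbolic_parabolic]). The product of the first [n] of these divisors is about
    [al ^+ n * n`!], and in characteristic 0 the norm of [n`!] is at
    least [c ^+ n] for some positive [c] ([nanorm_fact_ge]), because at most one prime
    number has norm less than 1. So these recursions produce convergent series too
    ([majorant]).

    Analytic inverses, normal forms and their convergence all come from
    a single fixed point lemma for operators gaining one degree of precision
    ([fmap2_fixpoint]), applied on a ball for a Gauss norm. *)

Set Implicit Arguments.
Unset Strict Implicit.
Unset Printing Implicit Defensive.
Import Order.TTheory GRing.Theory Num.Theory.
Local Open Scope ring_scope.

(** * The ring of power series in two variables *)

Section Fps2Ring.
Context {K : fieldType}.
Implicit Types (f g h : fps2 K).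

Lemma fps2P f g : (forall i j, f i j = g i j) -> f = g.
Proof. by move=> fg; apply/funext => i; apply/funext => j. Qed.

Definition fps2_add f g : fps2 K := fun i j => f i j + g i j.
Definition fps2_opp f : fps2 K := fun i j => - f i j.
Definition fps2_scale (c : K) f : fps2 K := fun i j => c * f i j.

Fact fps2_addA : associative fps2_add.
Proof. by move=> f g h; apply: fps2P => i j; rewrite /fps2_add addrA. Qed.
Fact fps2_addC : commutative fps2_add.
Proof. by move=> f g; apply: fps2P => i j; rewrite /fps2_add addrC. Qed.
Fact fps2_add0 : left_id (fun _ _ => 0) fps2_add.
Proof. by move=> f; apply: fps2P => i j; rewrite /fps2_add add0r. Qed.
Fact fps2_addN : left_inverse (fun _ _ => 0) fps2_opp fps2_add.
Proof. by move=> f; apply: fps2P => i j; rewrite /fps2_add /fps2_opp addNr. Qed.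

HB.instance Definition _ := gen_eqMixin (fps2 K).
HB.instance Definition _ := gen_choiceMixin (fps2 K).
HB.instance Definition _ :=
  GRing.isZmodule.Build (fps2 K) fps2_addA fps2_addC fps2_add0 fps2_addN.

Definition fps2_trunc n f : {poly {poly K}} := \poly_(i < n) \poly_(j < n) f i j.

(** The coefficients of a product are those of a product of polynomials; this
    transports the ring axioms from bivariate polynomials. *)
Lemma fps2_mul_poly f g (p q : {poly {poly K}}) i j :
  (forall k l, (k <= i)%N -> (l <= j)%N -> p`_k`_l = f k l) ->
  (forall k l, (k <= i)%N -> (l <= j)%N -> q`_k`_l = g k l) ->
  (p * q)`_i`_j = fps2_mul f g i j.
Proof.
move=> pf qg; rewrite coefM coef_sum; apply: eq_bigr => k _.
rewrite coefM; apply: eq_bigr => l _.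
by rewrite pf ?qg // ?leq_subr // -ltnS ltn_ord.
Qed.

Lemma coef_fps2_trunc n f k l :
  (k < n)%N -> (l < n)%N -> (fps2_trunc n f)`_k`_l = f k l.
Proof. by move=> kn ln; rewrite coef_poly kn coef_poly ln. Qed.

Lemma fps2_mulE n f g i j : (i < n)%N -> (j < n)%N ->
  fps2_mul f g i j = (fps2_trunc n f * fps2_trunc n g)`_i`_j.
Proof.
move=> i_n j_n; apply/esym/fps2_mul_poly => k l ki lj; apply: coef_fps2_trunc;
  by [apply: leq_ltn_trans i_n | apply: leq_ltn_trans j_n].
Qed.

Fact fps2_mulA : associative (@fps2_mul K).
Proof.
move=> f g h; apply: fps2P => i j; pose n := (maxn i j).+1.
have [iN jN] : (i < n)%N /\ (j < n)%N by rewrite !ltnS leq_maxl leq_maxr.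
pose p f := fps2_trunc n f.
have pE f' k l : (k <= i)%N -> (l <= j)%N -> (p f')`_k`_l = f' k l.
  by move=> ki lj; rewrite coef_fps2_trunc ?(leq_ltn_trans ki) ?(leq_ltn_trans lj).
have pM f1 f2 k l : (k <= i)%N -> (l <= j)%N ->
    (p f1 * p f2)`_k`_l = fps2_mul f1 f2 k l.
  by move=> ki lj; rewrite -fps2_mulE // ?(leq_ltn_trans ki) ?(leq_ltn_trans lj).
rewrite -(@fps2_mul_poly f (fps2_mul g h) (p f) (p g * p h)); last 2 first.
- exact: pE.
- exact: pM.
by rewrite mulrA; apply: fps2_mul_poly; [exact: pM|exact: pE].
Qed.

Fact fps2_mulC : commutative (@fps2_mul K).
Proof.
move=> f g; apply: fps2P => i j; pose n := (maxn i j).+1.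
have [iN jN] : (i < n)%N /\ (j < n)%N by rewrite !ltnS leq_maxl leq_maxr.
by rewrite !(@fps2_mulE n) // mulrC.
Qed.

Fact fps2_mul1 : left_id (@fps2_one K) (@fps2_mul K).
Proof.
move=> f; apply: fps2P => i j; rewrite /fps2_mul /fps2_one.
rewrite big_ord_recl big_ord_recl /= mul1r !subn0 !big1 ?addr0 //.
  by move=> k _; rewrite big1 // => l _; rewrite mul0r.
by move=> k _; rewrite mul0r.
Qed.

Fact fps2_mulD : left_distributive (@fps2_mul K) +%R.
Proof.
move=> f g h; apply: fps2P => i j.
rewrite -[RHS]/(fps2_mul f h i j + fps2_mul g h i j) -big_split; apply: eq_bigr => k _ /=.
by rewrite -big_split; apply: eq_bigr => l _; rewrite mulrDl.
Qed.

Fact fps2_one_neq0 : (@fps2_one K) != 0.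
Proof.
apply/eqP => /(congr1 (fun f => f 0%N 0%N)) /eqP.
by rewrite /fps2_one /= oner_eq0.
Qed.

HB.instance Definition _ := GRing.Zmodule_isComNzRing.Build (fps2 K)
  fps2_mulA fps2_mulC fps2_mul1 fps2_mulD fps2_one_neq0.

Fact fps2_scaleA a b f : fps2_scale a (fps2_scale b f) = fps2_scale (a * b) f.
Proof. by apply: fps2P => i j; rewrite /fps2_scale mulrA. Qed.
Fact fps2_scale1 : left_id 1 fps2_scale.
Proof. by move=> f; apply: fps2P => i j; rewrite /fps2_scale mul1r. Qed.
Fact fps2_scaleDr : right_distributive fps2_scale +%R.
Proof. by move=> a f g; apply: fps2P => i j; rewrite /fps2_scale mulrDr. Qed.
Fact fps2_scaleDl f : {morph fps2_scale^~ f : a b / a + b}.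
Proof. by move=> a b; apply: fps2P => i j; rewrite /fps2_scale mulrDl. Qed.

HB.instance Definition _ := GRing.Zmodule_isLmodule.Build K (fps2 K)
  fps2_scaleA fps2_scale1 fps2_scaleDr fps2_scaleDl.

Fact fps2_scaleAl (a : K) f g : a *: (f * g) = a *: f * g.
Proof.
apply: fps2P => i j; rewrite [LHS]mulr_sumr; apply: eq_bigr => k _ /=.
by rewrite mulr_sumr; apply: eq_bigr => l _; rewrite mulrA.
Qed.

HB.instance Definition _ := GRing.Lmodule_isLalgebra.Build K (fps2 K) fps2_scaleAl.
HB.instance Definition _ := GRing.Lalgebra_isComAlgebra.Build K (fps2 K).

Lemma fps2_coef0 i j : (0 : fps2 K) i j = 0. Proof. by []. Qed.
Lemma fps2_coefD f g i j : (f + g) i j = f i j + g i j. Proof. by []. Qed.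
Lemma fps2_coefN f i j : (- f) i j = - f i j. Proof. by []. Qed.
Lemma fps2_coefB f g i j : (f - g) i j = f i j - g i j. Proof. by []. Qed.
Lemma fps2_coefZ c f i j : (c *: f) i j = c * f i j. Proof. by []. Qed.
Lemma fps2_coef1 i j : (1 : fps2 K) i j = ((i == 0%N) && (j == 0%N))%:R.
Proof. by []. Qed.
Lemma fps2_coefM f g i j :
  (f * g) i j = \sum_(k < i.+1) \sum_(l < j.+1) f k l * g (i - k)%N (j - l)%N.
Proof. by []. Qed.
Lemma fps2_coef_sum (I : Type) (r : seq I) (P : pred I) (F : I -> fps2 K) i j :
  (\sum_(k <- r | P k) F k) i j = \sum_(k <- r | P k) F k i j.
Proof.
by elim/big_rec2: _ => [//|k y x _ <-]; rewrite fps2_coefD.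
Qed.
Lemma fps2_expE f n : fps2_exp f n = f ^+ n.
Proof. by elim: n => [//|n IH]; rewrite exprS -IH. Qed.
End Fps2Ring.

(** * Order of vanishing *)

Section Order.
Context {K : fieldType}.
Implicit Types (f g h : fps2 K) (P Q : fmap2 K).

Definition ord_ge n f := forall i j, (i + j < n)%N -> f i j = 0.

Lemma ord_ge_le m n f : (m <= n)%N -> ord_ge n f -> ord_ge m f.
Proof. by move=> mn fn i j ij; apply: fn; apply: leq_trans mn. Qed.

Lemma ord_ge_eq0 f : (forall n, ord_ge n f) -> f = 0.
Proof. by move=> f0; apply: fps2P => i j; apply: (f0 (i + j).+1). Qed.

Lemma ord_geD n f g : ord_ge n f -> ord_ge n g -> ord_ge n (f + g).
Proof. by move=> fn gn i j ij; rewrite fps2_coefD fn ?gn ?addr0. Qed.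

Lemma ord_geN n f : ord_ge n f -> ord_ge n (- f).
Proof. by move=> fn i j ij; rewrite fps2_coefN fn ?oppr0. Qed.

Lemma ord_geB n f g : ord_ge n f -> ord_ge n g -> ord_ge n (f - g).
Proof. by move=> fn gn; apply: ord_geD => //; apply: ord_geN. Qed.

Lemma ord_ge_sum n (I : Type) (r : seq I) (A : pred I) (F : I -> fps2 K) :
  (forall i, A i -> ord_ge n (F i)) -> ord_ge n (\sum_(i <- r | A i) F i).
Proof. by move=> Fn; apply: big_ind => //; apply: ord_geD. Qed.

Lemma ord_geM m n f g : ord_ge m f -> ord_ge n g -> ord_ge (m + n) (f * g).
Proof.
move=> fm gn i j ij; rewrite fps2_coefM big1 // => k _; rewrite big1 // => l _.
have [klm|mkl] := ltnP (k + l) m; first by rewrite fm ?mul0r.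
by rewrite gn ?mulr0 //; have := ltn_ord k; have := ltn_ord l; lia.
Qed.

Lemma ord_geX m n f : ord_ge m f -> ord_ge (m * n) (f ^+ n).
Proof.
move=> fm; elim: n => [|n IH]; first by rewrite muln0.
by rewrite exprS mulnS; apply: ord_geM.
Qed.

Lemma ord_geX1 n f : ord_ge 1 f -> ord_ge n (f ^+ n).
Proof. by move=> f1; have := @ord_geX 1 n f f1; rewrite mul1n. Qed.

Lemma ord_ge1 f : f 0%N 0%N = 0 -> ord_ge 1 f.
Proof. by move=> f0 [|i] [|j]. Qed.

Lemma ord_ge_trans n f g h : ord_ge n (f - g) -> ord_ge n (g - h) -> ord_ge n (f - h).
Proof. by move=> fg gh; rewrite -(subrK g f) -addrA; apply: ord_geD. Qed.

Lemma ord_geBC n f g : ord_ge n (f - g) -> ord_ge n (g - f).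
Proof. by move=> fg; rewrite -opprB; apply: ord_geN. Qed.

Lemma ord_geBM n f f' g g' :
  ord_ge n (f - f') -> ord_ge n (g - g') -> ord_ge n (f * g - f' * g').
Proof.
move=> ff gg; rewrite (_ : _ - _ = f * (g - g') + (f - f') * g'); last by ring.
by apply: ord_geD; [rewrite -[n]add0n|rewrite -[n]addn0]; apply: ord_geM.
Qed.

(** Raising to a power a series of positive order gains precision: this is what
    makes the nonlinear part of a map act as a contraction. *)
Lemma ord_geBX m k f g : ord_ge 1 f -> ord_ge 1 g -> ord_ge m.+1 (f - g) ->
  ord_ge (m + k) (f ^+ k - g ^+ k).
Proof.
move=> f1 g1 fg; case: k => [|k]; first by rewrite subrr.
rewrite subrXX -addSnnS; apply: ord_geM => //; apply: ord_ge_sum => i _.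
apply: (@ord_ge_le _ ((k.+1.-1 - i) + i)).
  by have := ltn_ord i; lia.
by apply: ord_geM; apply: ord_geX1.
Qed.

(** * Substitution *)

Definition monomial_at P k l := P.1 ^+ k * P.2 ^+ l.

Lemma fps2_mul_exp P k l :
  fps2_mul (fps2_exp P.1 k) (fps2_exp P.2 l) = monomial_at P k l.
Proof. by rewrite !fps2_expE. Qed.

Lemma ord_ge_monomial_at P k l :
  fixes_origin P -> ord_ge (k + l) (monomial_at P k l).
Proof.
by move=> [P1 P2]; apply: ord_geM; apply: ord_geX1; apply: ord_ge1.
Qed.

(** Each factor of a monomial has order 1, so replacing one factor by
    an approximation of it yields an error of order one less than
    the sum of the two degrees. *)
Lemma ord_geB_monomial_at m k l P Q :
  fixes_origin P -> fixes_origin Q ->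
  ord_ge m.+1 (P.1 - Q.1) -> ord_ge m.+1 (P.2 - Q.2) ->
  ord_ge (m + (k + l)) (monomial_at P k l - monomial_at Q k l).
Proof.
move=> [P1 P2] [Q1 Q2] PQ1 PQ2; rewrite /monomial_at.
rewrite (_ : _ - _ = (P.1 ^+ k - Q.1 ^+ k) * P.2 ^+ l
                   + Q.1 ^+ k * (P.2 ^+ l - Q.2 ^+ l)); last by ring.
apply: ord_geD.
  rewrite addnA; apply: ord_geM; first by apply: ord_geBX => //; apply: ord_ge1.
  by apply: ord_geX1; apply: ord_ge1.
rewrite addnCA; apply: ord_geM; last by apply: ord_geBX => //; apply: ord_ge1.
by apply: ord_geX1; apply: ord_ge1.
Qed.

Lemma fps2_compE n f P i j : fixes_origin P -> (i + j < n)%N ->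
  fps2_comp f P i j = \sum_(k < n) \sum_(l < n) f k l * monomial_at P k l i j.
Proof.
move=> P0 ijn; rewrite /fps2_comp.
pose t k l := f k l * monomial_at P k l i j.
have t0 k l : (i + j < k + l)%N -> t k l = 0.
  by move=> kl; rewrite /t (ord_ge_monomial_at P0) ?mulr0.
rewrite (eq_bigr (fun k : 'I__ => \sum_(l < n) t k l)) => [|k _].
  rewrite -!(big_mkord xpredT (fun k => \sum_(l < n) t k l)).
  rewrite [RHS](big_cat_nat (n := (i + j).+1)) //= [X in _ + X]big_nat_cond [X in _ + X]big1 ?addr0 //.
  by move=> k /andP[/andP[+ _] _] => ijk; rewrite big1 // => l _; apply: t0; lia.
rewrite (eq_bigr (fun l : 'I__ => t k l)) => [|l _]; last first.
  by rewrite fps2_mul_exp.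
rewrite -!(big_mkord xpredT (fun l => t k l)).
rewrite [RHS](big_cat_nat (n := (i + j).+1)) //= [X in _ + X]big_nat_cond [X in _ + X]big1 ?addr0 //.
by move=> l /andP[/andP[+ _] _] => ijl; apply: t0; lia.
Qed.

Lemma fps2_compD f g P : fps2_comp (f + g) P = fps2_comp f P + fps2_comp g P.
Proof.
apply: fps2P => i j; rewrite fps2_coefD -big_split; apply: eq_bigr => k _ /=.
by rewrite -big_split; apply: eq_bigr => l _; rewrite mulrDl.
Qed.

Lemma fps2_compZ (c : K) f P : fps2_comp (c *: f) P = c *: fps2_comp f P.
Proof.
apply: fps2P => i j; rewrite fps2_coefZ [RHS]mulr_sumr; apply: eq_bigr => k _.
by rewrite mulr_sumr; apply: eq_bigr => l _; rewrite mulrA.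
Qed.

Lemma fps2_compN f P : fps2_comp (- f) P = - fps2_comp f P.
Proof. by rewrite -scaleN1r fps2_compZ scaleN1r. Qed.

Lemma fps2_compB f g P : fps2_comp (f - g) P = fps2_comp f P - fps2_comp g P.
Proof. by rewrite fps2_compD fps2_compN. Qed.

Lemma fps2_comp0 P : fps2_comp 0 P = 0.
Proof. by have := fps2_compZ 0 0 P; rewrite !scale0r. Qed.

Lemma fps2_comp_sum (I : Type) (r : seq I) (A : pred I) (F : I -> fps2 K) P :
  fps2_comp (\sum_(i <- r | A i) F i) P = \sum_(i <- r | A i) fps2_comp (F i) P.
Proof. by apply: (big_morph (fps2_comp^~ P)) => [f g|]; rewrite ?fps2_compD ?fps2_comp0. Qed.

Lemma ord_ge_comp n f P : fixes_origin P -> ord_ge n f -> ord_ge n (fps2_comp f P).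
Proof.
move=> P0 fn i j ij; rewrite /fps2_comp big1 // => k _; rewrite big1 // => l _.
have [kln|nkl] := ltnP (k + l) n; first by rewrite fn ?mul0r.
rewrite fps2_mul_exp (ord_ge_monomial_at P0) ?mulr0 //; lia.
Qed.

(** Only monomials of degree at least [d] occur in [f], and the values of each of them
    agree to [d - 1] more degrees than the maps. *)
Lemma ord_geB_comp m d f P Q : fixes_origin P -> fixes_origin Q ->
  ord_ge m.+1 (P.1 - Q.1) -> ord_ge m.+1 (P.2 - Q.2) -> ord_ge d f ->
  ord_ge (m + d) (fps2_comp f P - fps2_comp f Q).
Proof.
move=> P0 Q0 PQ1 PQ2 fd i j ij; rewrite fps2_coefB.
rewrite (fps2_compE f P0 (ltnSn _)) (fps2_compE f Q0 (ltnSn _)) -sumrB.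
rewrite big1 // => k _; rewrite -sumrB big1 // => l _; rewrite -mulrBr -fps2_coefB.
have [kld|dkl] := ltnP (k + l) d; first by rewrite fd ?mul0r.
by rewrite (ord_geB_monomial_at P0 Q0 PQ1 PQ2) ?mulr0 //; lia.
Qed.

Lemma coef_xM f i j :
  (fps2_x * f : fps2 K) i j = if i is i'.+1 then f i' j else 0.
Proof.
rewrite fps2_coefM; case: i => [|i].
  by rewrite big_ord1 big1 // => l _; rewrite mul0r.
rewrite big_ord_recl big1 ?add0r; last by move=> l _; rewrite mul0r.
rewrite big_ord_recl [X in _ + X]big1 ?addr0; last first.
  by move=> k _; rewrite big1 // => l _; rewrite mul0r.
rewrite big_ord_recl big1 ?addr0; last by move=> l _; rewrite mul0r.
by rewrite mul1r !subn0 subn1.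
Qed.

Lemma coef_yM f i j :
  (fps2_y * f : fps2 K) i j = if j is j'.+1 then f i j' else 0.
Proof.
rewrite fps2_coefM big_ord_recl [X in _ + X]big1 ?addr0; last first.
  by move=> k _; rewrite big1 // => l _; rewrite mul0r.
case: j => [|j].
  by rewrite big_ord1 mul0r.
rewrite big_ord_recl mul0r add0r big_ord_recl big1 ?addr0; last first.
  by move=> l _; rewrite mul0r.
by rewrite mul1r !subn0 subn1.
Qed.

Lemma coef_xXM k f i j :
  (fps2_x ^+ k * f : fps2 K) i j = if (k <= i)%N then f (i - k)%N j else 0.
Proof.
elim: k i => [|k IH] i; first by rewrite expr0 mul1r subn0.
by rewrite exprS -mulrA coef_xM; case: i.
Qed.

Lemma coef_yXM k f i j :
  (fps2_y ^+ k * f : fps2 K) i j = if (k <= j)%N then f i (j - k)%N else 0.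
Proof.
elim: k j => [|k IH] j; first by rewrite expr0 mul1r subn0.
by rewrite exprS -mulrA coef_yM; case: j.
Qed.

Lemma coef_monomial k l i j :
  (fps2_x ^+ k * fps2_y ^+ l : fps2 K) i j = ((i == k) && (j == l))%:R.
Proof.
rewrite coef_xXM -[fps2_y ^+ l]mulr1 coef_yXM fps2_coef1.
case: leqP => ki; last by rewrite (ltn_eqF ki).
case: leqP => lj; last by rewrite (ltn_eqF lj) andbF.
by rewrite !subn_eq0 [i == k]eqn_leq [j == l]eqn_leq ki lj !andbT.
Qed.

Lemma monomial_at_id k l : monomial_at fmap2_id k l = fps2_x ^+ k * fps2_y ^+ l.
Proof. by []. Qed.

Lemma sum_ord2_delta (n : nat) (F : nat -> nat -> K) k l : (k < n)%N -> (l < n)%N ->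
  \sum_(i < n) \sum_(j < n) ((i == k :> nat) && (j == l :> nat))%:R * F i j = F k l.
Proof.
move=> kn ln; rewrite (bigD1 (Ordinal kn)) //= (bigD1 (Ordinal ln)) //= !eqxx mul1r.
rewrite big1 ?addr0 => [|j jl]; last first.
  by rewrite (_ : (j == l :> nat) = false) ?mul0r //; apply: contraNF jl => /eqP jl; apply/eqP/val_inj.
rewrite big1 ?addr0 // => i ik; rewrite big1 // => j _.
by rewrite (_ : (i == k :> nat) = false) ?mul0r //; apply: contraNF ik => /eqP ik; apply/eqP/val_inj.
Qed.

Lemma fps2_comp_monomial k l P : fixes_origin P ->
  fps2_comp (fps2_x ^+ k * fps2_y ^+ l) P = monomial_at P k l.
Proof.
move=> P0; apply: fps2P => i j.
rewrite (@fps2_compE (i + j + k + l).+1) //; last by lia.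
under eq_bigr do under eq_bigr do rewrite coef_monomial.
by rewrite (sum_ord2_delta (fun k l => monomial_at P k l i j)) //; lia.
Qed.

(** Truncation by bidegree rather than by total degree: it keeps some terms
    of degree [n] and more. *)
Definition fps2_jet n f : fps2 K :=
  \sum_(k < n) \sum_(l < n) f k l *: (fps2_x ^+ k * fps2_y ^+ l).

Lemma ord_ge_jet n f : ord_ge n (f - fps2_jet n f).
Proof.
move=> i j ij; rewrite fps2_coefB /fps2_jet fps2_coef_sum.
under eq_bigr do rewrite fps2_coef_sum.
under eq_bigr do under eq_bigr do rewrite fps2_coefZ coef_monomial mulrC.
under eq_bigr => k _ do under eq_bigr => l _ do rewrite [(i == _)]eq_sym [(j == _)]eq_sym.
by rewrite (sum_ord2_delta f) ?subrr //; lia.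
Qed.

Lemma fps2_comp_jet n f P : fixes_origin P ->
  fps2_comp (fps2_jet n f) P = \sum_(k < n) \sum_(l < n) f k l *: monomial_at P k l.
Proof.
move=> P0; rewrite fps2_comp_sum; apply: eq_bigr => k _.
rewrite fps2_comp_sum; apply: eq_bigr => l _.
by rewrite fps2_compZ fps2_comp_monomial.
Qed.

Lemma fps2_comp_jet_ord n f P : fixes_origin P ->
  ord_ge n (fps2_comp f P - fps2_comp (fps2_jet n f) P).
Proof. by move=> P0; rewrite -fps2_compB; apply: ord_ge_comp => //; apply: ord_ge_jet. Qed.

Lemma monomial_atM P k l k' l' :
  monomial_at P k l * monomial_at P k' l' = monomial_at P (k + k') (l + l').
Proof. by rewrite /monomial_at !exprD; ring. Qed.

(** On jets, substitution is multiplicative because it is so on monomials. *)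
Lemma fps2_compM f g P : fixes_origin P ->
  fps2_comp (f * g) P = fps2_comp f P * fps2_comp g P.
Proof.
move=> P0; apply/eqP; rewrite -subr_eq0; apply/eqP; apply: ord_ge_eq0 => n.
apply: (@ord_ge_trans _ _ (fps2_comp (fps2_jet n f * fps2_jet n g) P)).
  rewrite -fps2_compB; apply: ord_ge_comp => //.
  by apply: ord_geBM; apply: ord_ge_jet.
rewrite (_ : fps2_comp (_ * _) P = fps2_comp (fps2_jet n f) P * fps2_comp (fps2_jet n g) P).
  by apply: ord_geBM; apply: ord_geBC; apply: fps2_comp_jet_ord.
rewrite !fps2_comp_jet // /fps2_jet.
rewrite mulr_suml [RHS]mulr_suml fps2_comp_sum; apply: eq_bigr => k _.
rewrite mulr_suml [RHS]mulr_suml fps2_comp_sum; apply: eq_bigr => l _.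
rewrite mulr_sumr [RHS]mulr_sumr fps2_comp_sum; apply: eq_bigr => k' _.
rewrite mulr_sumr [RHS]mulr_sumr fps2_comp_sum; apply: eq_bigr => l' _.
rewrite -!scalerAl -!scalerAr !scalerA monomial_atM fps2_compZ.
by rewrite -!monomial_at_id monomial_atM monomial_at_id fps2_comp_monomial.
Qed.

Lemma fps2_comp1 P : fixes_origin P -> fps2_comp 1 P = 1.
Proof.
by move=> P0; have := fps2_comp_monomial 0 0 P0; rewrite /monomial_at !expr0 mulr1.
Qed.

Lemma fps2_compX f n P : fixes_origin P -> fps2_comp (f ^+ n) P = fps2_comp f P ^+ n.
Proof.
move=> P0; elim: n => [|n IH]; first by rewrite !expr0 fps2_comp1.
by rewrite !exprS fps2_compM ?IH.
Qed.

Lemma fps2_comp_x P : fixes_origin P -> fps2_comp fps2_x P = P.1.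
Proof.
by move=> P0; have := fps2_comp_monomial 1 0 P0; rewrite /monomial_at !expr0 !expr1 !mulr1.
Qed.

Lemma fps2_comp_y P : fixes_origin P -> fps2_comp fps2_y P = P.2.
Proof.
by move=> P0; have := fps2_comp_monomial 0 1 P0; rewrite /monomial_at !expr0 !expr1 !mul1r.
Qed.

Lemma fps2_comp_coef0 f P : fixes_origin P -> fps2_comp f P 0%N 0%N = f 0%N 0%N.
Proof.
move=> P0; rewrite (fps2_compE f P0 (ltnSn _)) !big_ord1 /monomial_at !expr0 mulr1.
by rewrite fps2_coef1 mulr1.
Qed.

Lemma fixes_origin_comp P Q :
  fixes_origin P -> fixes_origin Q -> fixes_origin (fmap2_comp P Q).
Proof. by move=> [P1 P2] Q0; split; rewrite /= fps2_comp_coef0. Qed.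

Lemma fps2_comp_id f : fps2_comp f fmap2_id = f.
Proof.
have id0 : fixes_origin fmap2_id by [].
apply/eqP; rewrite -subr_eq0; apply/eqP; apply: ord_ge_eq0 => n.
apply: (@ord_ge_trans _ _ (fps2_comp (fps2_jet n f) fmap2_id)).
  exact: fps2_comp_jet_ord.
by rewrite fps2_comp_jet //; apply: ord_geBC; apply: ord_ge_jet.
Qed.

Lemma fps2_comp_monomial_at P Q k l : fixes_origin Q ->
  fps2_comp (monomial_at P k l) Q = monomial_at (fmap2_comp P Q) k l.
Proof. by move=> Q0; rewrite fps2_compM // !fps2_compX. Qed.

(** On jets this is multiplicativity; both sides only depend on a jet
    up to any given order. *)
Lemma fps2_comp_comp f P Q : fixes_origin P -> fixes_origin Q ->
  fps2_comp (fps2_comp f P) Q = fps2_comp f (fmap2_comp P Q).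
Proof.
move=> P0 Q0; have PQ0 := fixes_origin_comp P0 Q0.
apply/eqP; rewrite -subr_eq0; apply/eqP; apply: ord_ge_eq0 => n.
apply: (@ord_ge_trans _ _ (fps2_comp (fps2_comp (fps2_jet n f) P) Q)).
  by rewrite -fps2_compB; apply: ord_ge_comp => //; apply: fps2_comp_jet_ord.
rewrite (_ : fps2_comp _ Q = fps2_comp (fps2_jet n f) (fmap2_comp P Q)).
  by apply: ord_geBC; apply: fps2_comp_jet_ord.
rewrite !fps2_comp_jet // fps2_comp_sum; apply: eq_bigr => k _.
rewrite fps2_comp_sum; apply: eq_bigr => l _.
by rewrite fps2_compZ fps2_comp_monomial_at.
Qed.

Lemma fmap2_compA P Q (S : fmap2 K) : fixes_origin Q -> fixes_origin S ->
  fmap2_comp (fmap2_comp P Q) S = fmap2_comp P (fmap2_comp Q S).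
Proof. by move=> Q0 S0; congr (_, _); apply: fps2_comp_comp. Qed.

Lemma fmap2_comp_idr P : fmap2_comp P fmap2_id = P.
Proof. by case: P => P1 P2; rewrite /fmap2_comp !fps2_comp_id. Qed.

Lemma fmap2_comp_idl P : fixes_origin P -> fmap2_comp fmap2_id P = P.
Proof. by case: P => P1 P2 P0; rewrite /fmap2_comp fps2_comp_x // fps2_comp_y. Qed.

End Order.

(** * Gauss norms *)

Section Norm.
Context {R : realType} {K : fieldType} (v : nonarch_norm R K).

Lemma nanorm0 : v 0 = 0.
Proof. by apply/eqP; rewrite nanorm_eq0. Qed.

Lemma nanorm_gt0 x : (0 < v x) = (x != 0).
Proof. by rewrite lt_def nanorm_ge0 andbT nanorm_eq0. Qed.

Lemma nanorm1 : v 1 = 1.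
Proof.
have v1 : v 1 != 0 by rewrite nanorm_eq0 oner_eq0.
by apply: (mulfI v1); rewrite -nanormM !mulr1.
Qed.

Lemma nanormN x : v (- x) = v x.
Proof.
have vN1 : v (-1) = 1.
  apply/eqP; rewrite -(eqrXn2 (n := 2)) ?nanorm_ge0 //.
  by rewrite expr2 -nanormM mulrNN mulr1 nanorm1 expr1n.
by rewrite -mulN1r nanormM vN1 mul1r.
Qed.

Lemma nanormX x n : v (x ^+ n) = v x ^+ n.
Proof. by elim: n => [|n IH]; rewrite ?nanorm1 // !exprS nanormM IH. Qed.

Lemma nanormV x : v x^-1 = (v x)^-1.
Proof.
have [->|x0] := eqVneq x 0; first by rewrite invr0 nanorm0 invr0.
have vx0 : v x != 0 by rewrite nanorm_eq0.
by apply: (mulfI vx0); rewrite -nanormM !mulfV ?nanorm1.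
Qed.

Lemma nanormD_le x y C : v x <= C -> v y <= C -> v (x + y) <= C.
Proof. by move=> xC yC; apply: le_trans (nanormD v x y) _; rewrite ge_max xC. Qed.

Lemma nanormB_le x y C : v x <= C -> v y <= C -> v (x - y) <= C.
Proof. by move=> xC yC; apply: nanormD_le; rewrite ?nanormN. Qed.

Lemma nanorm_sum_le (I : Type) (r : seq I) (P : pred I) (F : I -> K) C :
  0 <= C -> (forall i, P i -> v (F i) <= C) -> v (\sum_(i <- r | P i) F i) <= C.
Proof.
move=> C0 FC; apply: (big_ind (fun x => v x <= C)) => //; first by rewrite nanorm0.
by move=> x y; apply: nanormD_le.
Qed.

Lemma nanorm_nat_le1 n : v n%:R <= 1.
Proof.
elim: n => [|n IH]; first by rewrite nanorm0.
by rewrite -natr1; apply: nanormD_le => //; rewrite nanorm1.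
Qed.

(** In an ultrametric space all triangles are isosceles. *)
Lemma nanormD_eq x y : v x < v y -> v (x + y) = v y.
Proof.
move=> xy; apply/eqP; rewrite eq_le; apply/andP; split.
  by apply: nanormD_le => //; apply: ltW.
rewrite leNgt; apply/negP => sy; have : v y < v y; last by rewrite ltxx.
rewrite -[X in v X < _](addKr x y) addrC; apply: le_lt_trans (nanormD _ _ _) _.
by rewrite gt_max sy nanormN.
Qed.

Lemma nanormB_eq_max x y : v x != v y -> v (x - y) = Num.max (v x) (v y).
Proof.
move=> xy; have [lt_xy|lt_yx|e] := ltgtP (v x) (v y).
- by rewrite nanormD_eq nanormN.
- by rewrite addrC nanormD_eq // nanormN.
- by rewrite e eqxx in xy.
Qed.

(** The Gauss norm of [f] on the polydisc of radius [1 / s] is at most [C]. *)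
Definition gauss_le (C s : R) (f : fps2 K) :=
  forall i j, v (f i j) <= C * s ^+ (i + j).

Lemma gauss_le_ge0 C s f : gauss_le C s f -> 0 <= C.
Proof. by move=> /(_ 0%N 0%N); rewrite mulr1; apply: le_trans; apply: nanorm_ge0. Qed.

Lemma gauss_leD C s f g : gauss_le C s f -> gauss_le C s g -> gauss_le C s (f + g).
Proof. by move=> fC gC i j; apply: nanormD_le; [apply: fC|apply: gC]. Qed.

Lemma gauss_leB C s f g : gauss_le C s f -> gauss_le C s g -> gauss_le C s (f - g).
Proof. by move=> fC gC i j; apply: nanormB_le; [apply: fC|apply: gC]. Qed.

Lemma gauss_leZ C s f c : gauss_le C s f -> gauss_le (v c * C) s (c *: f).
Proof.
by move=> fC i j; rewrite fps2_coefZ nanormM -mulrA ler_wpM2l ?nanorm_ge0.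
Qed.

Lemma gauss_leM C D s f g : 0 <= s ->
  gauss_le C s f -> gauss_le D s g -> gauss_le (C * D) s (f * g).
Proof.
move=> s0 fC gD i j; have C0 := gauss_le_ge0 fC; have D0 := gauss_le_ge0 gD.
have CDs0 : 0 <= C * D * s ^+ (i + j) by rewrite !mulr_ge0 // exprn_ge0.
rewrite fps2_coefM; apply: nanorm_sum_le => // k _; apply: nanorm_sum_le => // l _.
have -> : (i + j = (k + l) + (i - k + (j - l)))%N.
  by have := ltn_ord k; have := ltn_ord l; lia.
rewrite nanormM exprD mulrACA; apply: ler_pM; rewrite ?nanorm_ge0 //.
Qed.

Lemma gauss_le1 s : 0 <= s -> gauss_le 1 s 1.
Proof.
move=> s0 i j; rewrite fps2_coef1 mul1r.
case: eqP => [->|_]; case: eqP => [->|_]; rewrite ?nanorm1 ?nanorm0 //= ?exprn_ge0 //.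
Qed.

Lemma gauss_leX C s f n : 0 <= s -> gauss_le C s f -> gauss_le (C ^+ n) s (f ^+ n).
Proof.
move=> s0 fC; elim: n => [|n IH]; first exact: gauss_le1.
by rewrite !exprS; apply: gauss_leM.
Qed.

Lemma gauss_le_weaken C D s r f : 0 <= s -> C <= D -> s <= r ->
  gauss_le C s f -> gauss_le D r f.
Proof.
move=> s0 CD sr fC i j; apply: le_trans (fC i j) _.
by apply: ler_pM => //; [apply: gauss_le_ge0 fC|rewrite exprn_ge0|apply: lerXn2r; rewrite ?nnegrE // (le_trans s0)].
Qed.

Lemma gauss_le_monomial_at C s (P : fmap2 K) k l : 0 <= s ->
  gauss_le C s P.1 -> gauss_le C s P.2 ->
  gauss_le (C ^+ (k + l)) s (monomial_at P k l).
Proof. by move=> s0 P1 P2; rewrite exprD; apply: gauss_leM => //; apply: gauss_leX. Qed.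

(** Composing on the right with a map of Gauss norm at most [1 / s] does not
    increase Gauss norms, and a vanishing order provides additional factors [s * E]. *)
Lemma gauss_le_comp C s E r n f (P : fmap2 K) : fixes_origin P ->
  0 <= s -> 0 <= r -> s * E <= 1 -> ord_ge n f ->
  gauss_le C s f -> gauss_le E r P.1 -> gauss_le E r P.2 ->
  gauss_le (C * (s * E) ^+ n) r (fps2_comp f P).
Proof.
move=> P0 s0 r0 sE fn fC P1 P2 i j; have C0 := gauss_le_ge0 fC.
have E0 := gauss_le_ge0 P1; have sE0 : 0 <= s * E by rewrite mulr_ge0.
have b0 : 0 <= C * (s * E) ^+ n * r ^+ (i + j) by rewrite !mulr_ge0 ?exprn_ge0.
rewrite (fps2_compE f P0 (ltnSn _)).
apply: nanorm_sum_le => // k _; apply: nanorm_sum_le => // l _.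
have [kln|nkl] := ltnP (k + l) n; first by rewrite fn // mul0r nanorm0.
have Pkl := gauss_le_monomial_at k l r0 P1 P2 i j.
rewrite nanormM; apply: le_trans (ler_pM (nanorm_ge0 _ _) (nanorm_ge0 _ _) (fC k l) Pkl) _.
rewrite mulrA -[C * s ^+ _ * _]mulrA -exprMn ler_wpM2r ?exprn_ge0 // ler_wpM2l //.
by rewrite ler_wiXn2l.
Qed.

Definition geom_bounded (f : fps2 K) := exists C s, 0 < s /\ gauss_le C s f.

(** All terms have positive degree, so that the Gauss norm decreases at least
    linearly with the radius of the polydisc. *)
Lemma geom_bounded_small f e : geom_bounded f -> f 0%N 0%N = 0 -> 0 < e ->
  exists2 s, 0 < s & forall r, s <= r -> gauss_le e r f.
Proof.
move=> [C [s [s0 fC]]] f0 e0; have C0 := gauss_le_ge0 fC.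
exists (s * (1 + C / e)) => [|r sr]; first by rewrite mulr_gt0 // ltr_wpDr // divr_ge0 // ltW.
have sr' : s <= r.
  by apply: le_trans sr; rewrite -[leLHS]mulr1 ler_pM2l // lerDl divr_ge0 // ltW.
have r0 : 0 < r by apply: lt_le_trans sr'.
move=> i j; case ij: (i + j)%N => [|n].
  have [-> ->] : i = 0%N /\ j = 0%N by lia.
  by rewrite f0 nanorm0 mulr_ge0 ?exprn_ge0 // ltW.
apply: le_trans (fC i j) _; rewrite ij !exprS mulrA [leRHS]mulrA.
apply: ler_pM; rewrite ?mulr_ge0 ?exprn_ge0 // ?(ltW s0) //; last first.
  by apply: lerXn2r; rewrite ?nnegrE // ltW.
rewrite [e * r]mulrC -ler_pdivrMr //; apply: le_trans sr.
by rewrite mulrAC mulrC ler_pM2l // lerDr.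
Qed.

Lemma geom_bounded_comp f (P : fmap2 K) : fixes_origin P ->
  geom_bounded f -> geom_bounded P.1 -> geom_bounded P.2 -> geom_bounded (fps2_comp f P).
Proof.
move=> P0 [C [s [s0 fC]]] gP1 gP2; have [P10 P20] := P0.
have si0 : 0 < s^-1 by rewrite invr_gt0.
have [s1 s10 P1s] := geom_bounded_small gP1 P10 si0.
have [s2 s20 P2s] := geom_bounded_small gP2 P20 si0.
pose r := Num.max s1 s2; have r0 : 0 < r by rewrite lt_max s10.
exists (C * (s * s^-1) ^+ 0), r; split => //.
by apply: gauss_le_comp => //; rewrite ?(ltW s0) ?(ltW r0) ?mulfV ?gt_eqF //;
  [apply: P1s|apply: P2s]; rewrite le_max lexx ?orbT.
Qed.

Lemma geom_boundedD f g : geom_bounded f -> geom_bounded g -> geom_bounded (f + g).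
Proof.
move=> [C [s [s0 fC]]] [D [t [t0 gD]]]; exists (Num.max C D), (Num.max s t); split.
  by rewrite lt_max s0.
by apply: gauss_leD; [apply: gauss_le_weaken fC|apply: gauss_le_weaken gD];
  rewrite ?le_max ?lexx ?orbT // ltW.
Qed.

Lemma geom_boundedM f g : geom_bounded f -> geom_bounded g -> geom_bounded (f * g).
Proof.
move=> [C [s [s0 fC]]] [D [t [t0 gD]]]; exists (C * D), (Num.max s t); split.
  by rewrite lt_max s0.
by apply: gauss_leM; [rewrite le_max ltW|apply: gauss_le_weaken fC|apply: gauss_le_weaken gD];
  rewrite ?le_max ?lexx ?orbT // ltW.
Qed.

Lemma geom_boundedZ c f : geom_bounded f -> geom_bounded (c *: f).
Proof. by move=> [C [s [s0 fC]]]; exists (v c * C), s; split => //; apply: gauss_leZ. Qed.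

Lemma geom_boundedN f : geom_bounded f -> geom_bounded (- f).
Proof. by rewrite -scaleN1r; apply: geom_boundedZ. Qed.

Lemma geom_boundedB f g : geom_bounded f -> geom_bounded g -> geom_bounded (f - g).
Proof. by move=> gf gg; apply: geom_boundedD => //; apply: geom_boundedN. Qed.

Lemma geom_bounded_monomial k l : geom_bounded (fps2_x ^+ k * fps2_y ^+ l).
Proof.
exists 1, 1; split => // i j; rewrite coef_monomial expr1n mulr1.
exact: nanorm_nat_le1.
Qed.

Lemma geom_bounded_x : geom_bounded fps2_x.
Proof. by have := geom_bounded_monomial 1 0; rewrite mulr1. Qed.

Lemma geom_bounded_y : geom_bounded fps2_y.
Proof. by have := geom_bounded_monomial 0 1; rewrite mul1r. Qed.

End Norm.

(** * Analytic series are those with geometric growth *)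

#[local] Existing Instance totally_filter.

Section Analytic.
Local Open Scope classical_set_scope.
Import numFieldNormedType.Exports.
Context {R : realType} {K : fieldType} (v : nonarch_norm R K).

Lemma expr_lt_eventually (z e : R) : 0 <= z < 1 -> 0 < e ->
  exists N : nat, forall n, (N <= n)%N -> z ^+ n < e.
Proof.
move=> /andP[z0 z1] e0; have zlt : `|z| < 1 by rewrite ger0_norm.
have /cvgr0Pnorm_lt /(_ e e0) [N _ Ne] := cvg_expr zlt.
by exists N => n Nn; have := Ne n Nn; rewrite /= ger0_norm ?exprn_ge0.
Qed.

Lemma exists_small (e : R) : nontrivial_norm v -> 0 < e ->
  exists2 x : K, x != 0 & v x <= e.
Proof.
move=> [x [x0 vx1]] e0.
wlog vx : x x0 vx1 / v x < 1.
  move=> wl; have [|xge1] := ltP (v x) 1; first exact: (wl x).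
  apply: (wl x^-1); rewrite ?invr_eq0 // nanormV.
    by rewrite invr_eq1.
  by rewrite invf_lt1 // ?nanorm_gt0 // lt_def vx1.
have [|N Ne] := @expr_lt_eventually (v x) e _ e0; first by rewrite nanorm_ge0.
by exists (x ^+ N); rewrite ?expf_neq0 // nanormX ltW // Ne.
Qed.

Lemma partial_sumE (x : nat * nat -> K) (A : {fset nat * nat}) :
  partial_sum x A = \sum_(p <- A) x p.
Proof. by rewrite /partial_sum big_seq_fsetE. Qed.

(** The terms of a convergent family are bounded: outside some finite set each
    of them is a difference of two partial sums close to the limit. *)
Lemma cvg_geom_bounded r1 r2 f : nontrivial_norm v -> 0 < r1 -> 0 < r2 ->
  cvg_on_polydisc v r1 r2 f -> geom_bounded v f.
Proof.
move=> nontriv r10 r20 fcvg.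
have rm : 0 < Num.min r1 r2 by rewrite lt_min r10.
have [x x0 vx] := exists_small nontriv rm.
move: vx; rewrite le_min => /andP[xr1 xr2].
have [s /cvgr0Pnorm_lt /(_ 1 ltr01) [A0 _ A0P]] := fcvg x x xr1 xr2.
pose t (p : nat * nat) := f p.1 p.2 * x ^+ p.1 * x ^+ p.2.
pose C := 1 + \sum_(p <- A0) v (t p).
have C1 : 1 <= C by rewrite lerDl; apply: sumr_ge0 => p _; apply: nanorm_ge0.
have tC p : v (t p) <= C.
  have [pA|pA] := boolP (p \in A0).
    rewrite /C (big_fsetD1 p) //= addrA ler_wpDr ?lerDr //.
    by apply: sumr_ge0 => q _; apply: nanorm_ge0.
  apply: le_trans C1.
  have close A : (A0 `<=` A)%fset -> v (partial_sum t A - s) <= 1.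
    by move=> A0A; have := A0P A A0A; rewrite /= ger0_norm ?nanorm_ge0 // => /ltW.
  have -> : t p = (partial_sum t (p |` A0)%fset - s) - (partial_sum t A0 - s).
    by rewrite !partial_sumE big_fsetU1 //=; ring.
  by apply: nanormB_le; apply: close => //; apply: fsubsetU1.
have vx0 : 0 < v x by rewrite nanorm_gt0.
exists C, (v x)^-1; split; first by rewrite invr_gt0.
move=> i j; rewrite exprVn ler_pdivlMr ?exprn_gt0 //.
by rewrite exprD mulrA -!nanormX -!nanormM; apply: (tC (i, j)).
Qed.

Definition square n : {fset nat * nat} :=
  [fset p in [seq (i, j) | i <- iota 0 n, j <- iota 0 n]]%fset.

Lemma in_square n i j : ((i, j) \in square n) = (i < n)%N && (j < n)%N.
Proof.
rewrite in_fset_; apply/allpairsP/idP => [[[k l] /= [+ + [-> ->]]]|].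
  by rewrite !mem_iota /= !add0n => -> ->.
by move=> /andP[iN jN]; exists (i, j); rewrite !mem_iota !add0n.
Qed.

Lemma square_le m n : (m <= n)%N -> (square m `<=` square n)%fset.
Proof.
move=> mn; apply/fsubsetP => -[i j]; rewrite !in_square => /andP[im jm].
by rewrite !(leq_trans _ mn).
Qed.

(** The ultrametric inequality makes a family whose terms tend to 0 summable. *)
Lemma sum_outside_le (t : nat * nat -> K) n A C : 0 <= C ->
  (forall i j, (n <= i)%N || (n <= j)%N -> v (t (i, j)) <= C) ->
  (square n `<=` A)%fset -> v (partial_sum t A - partial_sum t (square n)) <= C.
Proof.
move=> C0 tC; move: (in_square n); move: (square n) => B inB BA.
rewrite !partial_sumE (big_fsetID _ (mem B) A) /=.
have -> : [fset x in A | x \in B]%fset = B.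
  apply/fsetP => p; rewrite !inE /= andbC; case: (boolP (p \in B)) => //=.
  by move/(fsubsetP BA).
rewrite addrAC subrr add0r big_seq; apply: nanorm_sum_le => // -[i j].
by rewrite !inE /= inB negb_and -!leqNgt => /andP[_ ij]; apply: tC.
Qed.

Lemma geom_bounded_cvg f : complete_norm v -> geom_bounded v f ->
  exists2 r, 0 < r & cvg_on_polydisc v r r f.
Proof.
move=> cpl [C [s [s0 fC]]]; have C0 := gauss_le_ge0 fC.
have r0 : 0 < (2 * s)^-1 by rewrite invr_gt0 mulr_gt0.
exists (2 * s)^-1 => // x y vx vy.
pose t (p : nat * nat) := f p.1 p.2 * x ^+ p.1 * y ^+ p.2.
have tC n i j : (n <= i)%N || (n <= j)%N -> v (t (i, j)) <= C * 2^-1 ^+ n.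
  move=> nij; have nij' : (n <= i + j)%N by lia.
  apply: (@le_trans _ _ (C * 2^-1 ^+ (i + j))); last first.
    by rewrite ler_wpM2l // ler_wiXn2l // ?invr_ge0 // invf_le1 ?ler1n.
  rewrite /t /= !nanormM !nanormX -mulrA.
  have -> : C * 2^-1 ^+ (i + j) = (C * s ^+ (i + j)) * ((2 * s)^-1 ^+ i * (2 * s)^-1 ^+ j) :> R.
    rewrite -exprD -mulrA -exprMn; congr (_ * _ ^+ _).
    by field; rewrite gt_eqF.
  by apply: ler_pM; rewrite ?nanorm_ge0 ?mulr_ge0 ?exprn_ge0 ?nanorm_ge0 //;
    apply: ler_pM; rewrite ?exprn_ge0 ?nanorm_ge0 // lerXn2r ?nnegrE ?nanorm_ge0 // ltW.
have Cn0 n : 0 <= C * 2^-1 ^+ n :> R by rewrite mulr_ge0 // exprn_ge0 // invr_ge0.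
have half : 0 <= (2^-1 : R) < 1 by rewrite invr_ge0 ler0n invf_lt1 ?ltr1n.
have small e : 0 < e -> exists N, C * 2^-1 ^+ N < e.
  move=> e0; have C10 : 0 < C + 1 by rewrite ltr_wpDl.
  have [|N Ne] := @expr_lt_eventually 2^-1 (e / (C + 1)) half; first by rewrite divr_gt0.
  exists N; have := Ne N (leqnn N); rewrite ltr_pdivlMr // mulrC; apply: le_lt_trans.
  by rewrite ler_wpM2r ?exprn_ge0 ?invr_ge0 // lerDl.
pose u n := partial_sum t (square n).
have uA N A : (square N `<=` A)%fset -> v (partial_sum t A - u N) <= C * 2^-1 ^+ N.
  by move=> NA; apply: sum_outside_le => // i j; apply: tC.
have [|l ul] := cpl u.
  move=> e e0; have [N Ne] := small e e0.
  exists ([set n | (N <= n)%N], [set n | (N <= n)%N]) => /=.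
    by split; exists N.
  move=> [m n] [/= Nm Nn]; apply: le_lt_trans Ne.
  rewrite (_ : u m - u n = (u m - u N) - (u n - u N)); last by ring.
  by apply: nanormB_le; apply: uA; apply: square_le.
exists l; apply/cvgr0Pnorm_lt => e e0.
have [N Ne] := small e e0.
exists (square N) => // A NA /=; rewrite ger0_norm ?nanorm_ge0 //.
have /cvgr0Pnorm_lt /(_ e e0) [M _ Me] := ul.
pose n := maxn M N.
have /= := Me n (leq_maxl M N); rewrite ger0_norm ?nanorm_ge0 // => une.
rewrite (_ : partial_sum _ A - l = ((partial_sum t A - u N) - (u n - u N)) + (u n - l)); last by ring.
apply: le_lt_trans (nanormD v _ _) _; rewrite gt_max une andbT.
apply: le_lt_trans Ne; apply: nanormB_le; apply: uA => //.
by apply: square_le; apply: leq_maxr.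
Qed.

Lemma analytic_geom_bounded (P : fmap2 K) : complete_norm v -> nontrivial_norm v ->
  analytic_fmap2 v P <-> geom_bounded v P.1 /\ geom_bounded v P.2.
Proof.
move=> cpl nontriv; split=> [[r1 [r2 [r10 r20 P1 P2]]]|[P1 P2]].
  by split; [apply: cvg_geom_bounded P1|apply: cvg_geom_bounded P2].
have [r1 r10 P1c] := geom_bounded_cvg cpl P1; have [r2 r20 P2c] := geom_bounded_cvg cpl P2.
have rm : 0 < Num.min r1 r2 by rewrite lt_min r10.
exists (Num.min r1 r2), (Num.min r1 r2); split => // x y;
  rewrite !le_min => /andP[x1 x2] /andP[y1 y2]; by [apply: P1c|apply: P2c].
Qed.

End Analytic.

(** * Fixed points in the space of formal maps *)

Section FixedPoint.
Context {K : fieldType}.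
Implicit Types (P Q : fmap2 K).

Definition agree n P Q := ord_ge n (P.1 - Q.1) /\ ord_ge n (P.2 - Q.2).

Lemma agreeC n P Q : agree n P Q -> agree n Q P.
Proof. by move=> [PQ1 PQ2]; split; apply: ord_geBC. Qed.

Lemma agree_trans n P Q S : agree n P Q -> agree n Q S -> agree n P S.
Proof. by move=> [? ?] [? ?]; split; [apply: (@ord_ge_trans _ _ _ Q.1)|apply: (@ord_ge_trans _ _ _ Q.2)]. Qed.

Lemma agree_le m n P Q : (m <= n)%N -> agree n P Q -> agree m P Q.
Proof. by move=> mn [? ?]; split; apply: ord_ge_le mn _. Qed.

Lemma agree_eq P Q : (forall n, agree n P Q) -> P = Q.
Proof.
case: P Q => [P1 P2] [Q1 Q2] PQ; congr (_, _); apply/eqP; rewrite -subr_eq0;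
  apply/eqP; apply: ord_ge_eq0 => n; have [H1 H2] := PQ n; by [exact: H1|exact: H2].
Qed.

(** The iterates agree to higher and higher order, so that each of their coefficients
    is eventually constant. This is why a constraint on individual coefficients
    passes to the limit. *)
Lemma fmap2_fixpoint (T : fmap2 K -> fmap2 K) (B1 B2 : nat -> nat -> K -> Prop)
    (inv := fun P : fmap2 K => forall i j, B1 i j (P.1 i j) /\ B2 i j (P.2 i j)) :
  inv (0, 0) -> (forall P, inv P -> inv (T P)) ->
  (forall n P Q, inv P -> inv Q -> agree n P Q -> agree n.+1 (T P) (T Q)) ->
  exists P, inv P /\ T P = P.
Proof.
move=> inv0 invT contr; pose u n := iter n T (0, 0).
have uinv n : inv (u n) by elim: n => //= n; apply: invT.
have uS n : agree n (u n) (u n.+1).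
  elim: n => [|n IH]; first by split.
  exact: contr (uinv n) (uinv n.+1) IH.
have uD n m : agree n (u n) (u (n + m)%N).
  elim: m => [|m IH]; first by rewrite addn0; split; rewrite subrr.
  by apply: agree_trans IH _; rewrite addnS; apply: agree_le (uS _); apply: leq_addr.
pose P : fmap2 K := (fun i j => (u (i + j).+1).1 i j, fun i j => (u (i + j).+1).2 i j).
have Pinv : inv P by move=> i j; split; have [] := uinv (i + j).+1 i j.
have uP n : agree n (u n) P.
  have E i j : (i + j < n)%N -> exists m, n = ((i + j).+1 + m)%N.
    by move=> ij; exists (n - (i + j).+1)%N; rewrite subnKC.
  split=> i j ij; have [m ->] := E i j ij; have [H1 H2] := uD (i + j).+1 m.
    by have /subr0_eq := H1 i j (ltnSn _); rewrite fps2_coefB /= => <-; rewrite subrr.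
  by have /subr0_eq := H2 i j (ltnSn _); rewrite fps2_coefB /= => <-; rewrite subrr.
exists P; split => //; apply: agree_eq => -[|n]; first by split.
apply: agree_trans (uP n.+1); apply: contr => //; exact: agreeC (uP n).
Qed.

End FixedPoint.

(** * Inverses of analytic maps *)

Section Inverse.
Context {R : realType} {K : fieldType} (v : nonarch_norm R K).

Definition diag_map (l1 l2 : K) : fmap2 K := (l1 *: fps2_x, l2 *: fps2_y).

Lemma diagonal_agree l1 l2 (F : fmap2 K) :
  has_diagonal_linear_part l1 l2 F <-> agree 2 F (diag_map l1 l2).
Proof. by []. Qed.

Lemma fixes_origin_diag l1 l2 : fixes_origin (diag_map l1 l2).
Proof. by split; rewrite /= fps2_coefZ mulr0. Qed.

Lemma diag_map1 : diag_map 1 1 = fmap2_id.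
Proof. by rewrite /diag_map !scale1r. Qed.

Definition geom_bounded2 (P : fmap2 K) := geom_bounded v P.1 /\ geom_bounded v P.2.

(** [Q] is the fixed point of [Q |-> L^-1 (id - p(Q))], where [L] is the linear part
    of [P] and [p] its nonlinear part. *)
Lemma right_inverse l1 l2 (P : fmap2 K) : l1 != 0 -> l2 != 0 ->
  fixes_origin P -> geom_bounded2 P -> has_diagonal_linear_part l1 l2 P ->
  exists Q, [/\ fixes_origin Q, geom_bounded2 Q,
    has_diagonal_linear_part l1^-1 l2^-1 Q & fmap2_comp P Q = fmap2_id].
Proof.
move=> l10 l20 P0 [gP1 gP2] [Pl1 Pl2].
pose p1 := P.1 - l1 *: fps2_x; pose p2 := P.2 - l2 *: fps2_y.
have gp1 : geom_bounded v p1 by apply: geom_boundedB gP1 _; apply: geom_boundedZ; apply: geom_bounded_x.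
have gp2 : geom_bounded v p2 by apply: geom_boundedB gP2 _; apply: geom_boundedZ; apply: geom_bounded_y.
have [C [s [C0 s0 p1C p2C]]] : exists C s, [/\ 0 < C, 0 < s, gauss_le v C s p1 & gauss_le v C s p2].
  have [C1 [s1 [s10 H1]]] := gp1; have [C2 [s2 [s20 H2]]] := gp2.
  exists (Num.max 1 (Num.max C1 C2)), (Num.max s1 s2); split.
  - by rewrite lt_max ltr01.
  - by rewrite lt_max s10.
  - by apply: gauss_le_weaken H1; rewrite ?le_max ?lexx ?orbT // ltW.
  - by apply: gauss_le_weaken H2; rewrite ?le_max ?lexx ?orbT // ltW.
pose d := Num.min (v l1) (v l2).
have d0 : 0 < d by rewrite lt_min !nanorm_gt0 l10.
(* The quadratic estimate [C * (s * E) ^+ 2] must be at most [d * E]: then the ball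
   of radius [E] is stable. It contains [L^-1] as [d * E * r = 1]. *)
pose E := Num.min s^-1 (d / (C * s ^+ 2)).
have E0 : 0 < E by rewrite lt_min invr_gt0 s0 divr_gt0 // mulr_gt0 // exprn_gt0.
pose r := (d * E)^-1; have r0 : 0 < r by rewrite invr_gt0 mulr_gt0.
have sE : s * E <= 1.
  by rewrite mulrC -ler_pdivlMr // mul1r ge_min lexx.
have CsE : C * (s * E) ^+ 2 <= d * E.
  rewrite (_ : C * (s * E) ^+ 2 = E * (C * s ^+ 2) * E); last by ring.
  by rewrite ler_pM2r // -ler_pdivlMr ?ge_min ?lexx ?orbT // mulr_gt0 // exprn_gt0.
pose T (Q : fmap2 K) : fmap2 K :=
  (l1^-1 *: (fps2_x - fps2_comp p1 Q), l2^-1 *: (fps2_y - fps2_comp p2 Q)).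
pose B (i j : nat) x := v x <= E * r ^+ (i + j) /\ ((i + j = 0)%N -> x = 0).
pose inv (P : fmap2 K) := forall i j, B i j (P.1 i j) /\ B i j (P.2 i j).
have inv0 Q : inv Q -> fixes_origin Q.
  by move=> Qi; have [[_ Q1] [_ Q2]] := Qi 0%N 0%N; split; [apply: Q1|apply: Q2].
have p10 : p1 0%N 0%N = 0 by rewrite /p1 fps2_coefB fps2_coefZ (proj1 P0) mulr0 subr0.
have p20 : p2 0%N 0%N = 0 by rewrite /p2 fps2_coefB fps2_coefZ (proj2 P0) mulr0 subr0.
have step (e p : fps2 K) l Q : inv Q -> gauss_le v C s p -> ord_ge 2 p -> d <= v l ->
    (forall i j, v (e i j) <= ((i + j)%N == 1%N)%:R) ->
    gauss_le v E r (l^-1 *: (e - fps2_comp p Q)).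
  move=> Qi pC p_2 dl eb i j; have Q0 := inv0 Q Qi.
  have Q1 : gauss_le v E r Q.1 by move=> k l'; have [[]] := Qi k l'.
  have Q2 : gauss_le v E r Q.2 by move=> k l'; have [_ []] := Qi k l'.
  rewrite fps2_coefZ nanormM nanormV mulrC ler_pdivrMr ?(lt_le_trans d0) //.
  apply: (@le_trans _ _ (d * E * r ^+ (i + j))); last first.
    rewrite -mulrA mulrC ler_wpM2l // mulr_ge0 ?exprn_ge0 // ltW //.
  apply: nanormB_le.
    apply: le_trans (eb i j) _; case: eqP => [->|_].
      by rewrite expr1 /r mulfV // gt_eqF // mulr_gt0.
    by rewrite !mulr_ge0 ?exprn_ge0 // ltW.
  apply: le_trans (gauss_le_comp Q0 (ltW s0) (ltW r0) sE p_2 pC Q1 Q2 i j) _.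
  by rewrite ler_wpM2r // exprn_ge0 // ltW.
have xb i j : v ((fps2_x : fps2 K) i j) <= ((i + j)%N == 1%N)%:R.
  by case: i j => [|[|i]] [|j]; rewrite /fps2_x /= ?nanorm0 ?nanorm1 ?ler01 ?lexx.
have yb i j : v ((fps2_y : fps2 K) i j) <= ((i + j)%N == 1%N)%:R.
  by case: i j => [|[|i]] [|[|j]]; rewrite /fps2_y /= ?nanorm0 ?nanorm1 ?ler01 ?lexx.
have [||n Q Q' Qi Qi' [QQ1 QQ2]|Q [Qi TQ]] := @fmap2_fixpoint _ T B B.
- by move=> i j; split; split => //=; rewrite nanorm0 mulr_ge0 ?exprn_ge0 // ltW.
- move=> Q Qi; have Q0 := inv0 Q Qi => i j; split; split.
  + by apply: step => //; rewrite ge_min lexx.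
  + move=> ij; have [-> ->] : i = 0%N /\ j = 0%N by lia.
    by rewrite /= fps2_coefZ fps2_coefB fps2_comp_coef0 // p10 subr0 mulr0.
  + by apply: step => //; rewrite ge_min lexx orbT.
  + move=> ij; have [-> ->] : i = 0%N /\ j = 0%N by lia.
    by rewrite /= fps2_coefZ fps2_coefB fps2_comp_coef0 // p20 subr0 mulr0.
- have Q0 := inv0 Q Qi; have Q0' := inv0 Q' Qi'.
  have contr (e p : fps2 K) l : ord_ge 2 p ->
      ord_ge n.+1 (l *: (e - fps2_comp p Q) - l *: (e - fps2_comp p Q')).
    move=> p_2; rewrite -scalerBr => i j ij; rewrite fps2_coefZ.
    rewrite (_ : _ - _ = fps2_comp p Q' - fps2_comp p Q); last by ring.
    suff -> : (fps2_comp p Q' - fps2_comp p Q) i j = 0 by rewrite mulr0.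
    case: n QQ1 QQ2 ij => [|n] QQ1 QQ2 ij.
      have [-> ->] : i = 0%N /\ j = 0%N by lia.
      by rewrite fps2_coefB !fps2_comp_coef0 // subrr.
    by apply: (@ord_geB_comp _ n 2) => //; [apply: ord_geBC|apply: ord_geBC|lia].
  by split; apply: contr.
have Q0 := inv0 Q Qi; exists Q.
have Q1E : Q.1 = l1^-1 *: (fps2_x - fps2_comp p1 Q) by rewrite -{1}TQ.
have Q2E : Q.2 = l2^-1 *: (fps2_y - fps2_comp p2 Q) by rewrite -{1}TQ.
split => //.
- by split; exists E, r; split => // i j; have [[? _] [? _]] := Qi i j.
- apply/diagonal_agree; split; rewrite /= ?Q1E ?Q2E -scalerBr => i j ij.
    rewrite fps2_coefZ (_ : _ - _ = - fps2_comp p1 Q); last by ring.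
    by rewrite fps2_coefN (ord_ge_comp Q0 Pl1) // oppr0 mulr0.
  rewrite fps2_coefZ (_ : _ - _ = - fps2_comp p2 Q); last by ring.
  by rewrite fps2_coefN (ord_ge_comp Q0 Pl2) // oppr0 mulr0.
- congr (_, _).
    rewrite -[P.1](subrK (l1 *: fps2_x)) -/p1 fps2_compD fps2_compZ fps2_comp_x //.
    by rewrite Q1E scalerA mulfV // scale1r addrC subrK.
  rewrite -[P.2](subrK (l2 *: fps2_y)) -/p2 fps2_compD fps2_compZ fps2_comp_y //.
  by rewrite Q2E scalerA mulfV // scale1r addrC subrK.
Qed.

(** A right inverse has itself a right inverse, which must be the original map;
    so it is a two-sided inverse. *)
Lemma geom_bounded_inverse l1 l2 (P : fmap2 K) : l1 != 0 -> l2 != 0 ->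
  fixes_origin P -> geom_bounded2 P -> has_diagonal_linear_part l1 l2 P ->
  exists Q, [/\ fixes_origin Q, geom_bounded2 Q,
    has_diagonal_linear_part l1^-1 l2^-1 Q & inverse_fmap2 P Q].
Proof.
move=> l10 l20 P0 gP Pl; have [Q [Q0 gQ Ql PQ]] := right_inverse l10 l20 P0 gP Pl.
have [||S [S0 _ _ QS]] := right_inverse _ _ Q0 gQ Ql; rewrite ?invr_eq0 //.
exists Q; split => //; split => //.
suff <- : S = P by [].
by rewrite -[S]fmap2_comp_idl // -PQ fmap2_compA // QS fmap2_comp_idr.
Qed.

End Inverse.

(** * Quasi-homogeneous series and resonances *)

Section Weights.
Context {K : fieldType} (a b : nat).
Implicit Types (f g : fps2 K) (P Q : fmap2 K).

(** [f] is quasi-homogeneous of weight [w], the variables having weights [a]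
    and [b]. When the eigenvalues are [t ^+ a] and [t ^+ b], these are the
    resonant terms. *)
Definition homog (w : nat) f := forall i j, (a * i + b * j)%N != w -> f i j = 0.

Lemma homogM w w' f g : homog w f -> homog w' g -> homog (w + w')%N (f * g).
Proof.
move=> fw gw i j ijw; rewrite fps2_coefM big1 // => k _; rewrite big1 // => l _.
have [klw|klw] := eqVneq (a * k + b * l)%N w; last by rewrite fw ?mul0r.
rewrite gw ?mulr0 //; apply: contra_neq ijw => e.
by rewrite -klw -e !mulnBr; have := ltn_ord k; have := ltn_ord l; rewrite !ltnS;
  move=> /(leq_mul (leqnn b)) ? /(leq_mul (leqnn a)) ?; lia.
Qed.

Lemma homog1 : homog 0%N (1 : fps2 K).
Proof. by move=> [|i] [|j] //; rewrite !muln0. Qed.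

Lemma homogX w f n : homog w f -> homog (w * n)%N (f ^+ n).
Proof.
move=> fw; elim: n => [|n IH]; first by rewrite muln0; apply: homog1.
by rewrite exprS mulnS; apply: homogM.
Qed.

Lemma homog_comp w f P : homog w f -> homog a P.1 -> homog b P.2 ->
  homog w (fps2_comp f P).
Proof.
move=> fw P1 P2 i j ijw; rewrite /fps2_comp big1 // => k _; rewrite big1 // => l _.
have [klw|klw] := eqVneq (a * k + b * l)%N w; last by rewrite fw ?mul0r.
rewrite fps2_mul_exp /monomial_at (homogM (homogX (n := k) P1) (homogX (n := l) P2)) ?mulr0 //.
by rewrite klw.
Qed.

Definition homog2 P := homog a P.1 /\ homog b P.2.

Definition mask (A : nat -> nat -> bool) f : fps2 K :=
  fun i j => if A i j then f i j else 0.

Lemma maskB A f g : mask A f - mask A g = mask A (f - g).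
Proof. by apply: fps2P => i j; rewrite fps2_coefB /mask; case: ifP => _; rewrite ?subr0. Qed.

Lemma ord_ge_mask A n f : ord_ge n f -> ord_ge n (mask A f).
Proof. by move=> fn i j ij; rewrite /mask fn // if_same. Qed.

Definition resonant (w : nat) i j := (1 < i + j)%N && (a * i + b * j == w)%N.
Definition nonresonant (w : nat) i j := (1 < i + j)%N && (a * i + b * j != w)%N.

Lemma ord_ge2_resonant w f : ord_ge 2 (mask (resonant w) f).
Proof. by move=> i j ij; rewrite /mask /resonant ltnNge -ltnS ij. Qed.

Lemma ord_ge2_nonresonant w f : ord_ge 2 (mask (nonresonant w) f).
Proof. by move=> i j ij; rewrite /mask /nonresonant ltnNge -ltnS ij. Qed.

Lemma fps2_comp_diag f l1 l2 i j :
  fps2_comp f (diag_map l1 l2) i j = l1 ^+ i * l2 ^+ j * f i j.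
Proof.
rewrite (fps2_compE f (fixes_origin_diag l1 l2) (ltnSn _)).
have E k l : monomial_at (diag_map l1 l2) k l =
    (l1 ^+ k * l2 ^+ l) *: (fps2_x ^+ k * fps2_y ^+ l).
  by rewrite /monomial_at /= !exprZn -scalerAl -scalerAr scalerA.
rewrite -(@sum_ord2_delta K (i + j).+1 (fun k l => l1 ^+ k * l2 ^+ l * f k l) i j) ?ltnS ?leq_addr ?leq_addl //.
apply: eq_bigr => k _; apply: eq_bigr => l _.
by rewrite E fps2_coefZ coef_monomial eq_sym [j == _]eq_sym; ring.
Qed.

End Weights.

(** * Convergent normal forms *)

Section Normalization.
Context {R : realType} {K : fieldType} (v : nonarch_norm R K).

(** The terms that contribute to the difference of the two substitutions involve a
    nonlinear term of one of the maps. On a polydisc smaller by the factor [e],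
    such a term is smaller by the factor [e] at least, compared with the linear terms. *)
Lemma gauss_le_compB C e s (f : fps2 K) (P Q : fmap2 K) :
  fixes_origin P -> fixes_origin Q -> agree 2 P Q -> 0 < e <= 1 -> 0 < s ->
  gauss_le v C (s / e) f ->
  gauss_le v s^-1 s P.1 -> gauss_le v s^-1 s P.2 ->
  gauss_le v s^-1 s Q.1 -> gauss_le v s^-1 s Q.2 ->
  gauss_le v (C * e) (s / e) (fps2_comp f P - fps2_comp f Q).
Proof.
move=> P0 Q0 [PQ1 PQ2] /andP[e0 e1] s0 fC P1 P2 Q1 Q2 i j.
have C0 := gauss_le_ge0 fC; have se0 : 0 < s / e by rewrite divr_gt0.
have b0 : 0 <= C * e * (s / e) ^+ (i + j) by rewrite !mulr_ge0 ?exprn_ge0 // ltW.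
rewrite fps2_coefB (fps2_compE f P0 (ltnSn _)) (fps2_compE f Q0 (ltnSn _)) -sumrB.
apply: nanorm_sum_le => // k _; rewrite -sumrB; apply: nanorm_sum_le => // l _.
rewrite -mulrBr -fps2_coefB.
have [ijkl|klij] := leqP (i + j) (k + l).
  rewrite (ord_geB_monomial_at (m := 1%N) P0 Q0) //.
  by rewrite mulr0 nanorm0.
have M : v ((monomial_at P k l - monomial_at Q k l) i j) <= s^-1 ^+ (k + l) * s ^+ (i + j).
  by apply: gauss_leB => //; apply: gauss_le_monomial_at => //; apply: ltW.
rewrite nanormM; apply: le_trans (ler_pM (nanorm_ge0 _ _) (nanorm_ge0 _ _) (fC k l) M) _.
have [n ijE] : exists n, (i + j = k + l + n.+1)%N by exists (i + j - (k + l)).-1; lia.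
have -> : C * (s / e) ^+ (k + l) * (s^-1 ^+ (k + l) * s ^+ (i + j)) =
          C * e * (s / e) ^+ (i + j) * e ^+ n.
  move: ijE; move: (k + l)%N => p; move: (i + j)%N => q ->.
  rewrite !exprD !exprMn !exprVn !exprS; field.
  by rewrite !expf_neq0 ?gt_eqF.
by rewrite ler_piMr // exprn_ile1 // ltW.
Qed.

(** In the shape [s^-1], [s] of the bound, monomials of degree [k] in such series are
    bounded by [s ^+ (n - k)] in degree [n]. *)
Lemma gauss_le_tangent (f : fps2 K) : geom_bounded v f -> f 0%N 0%N = 0 ->
  (forall i j, (i + j = 1)%N -> v (f i j) <= 1) ->
  exists2 s, 0 < s & forall r, s <= r -> gauss_le v r^-1 r f.
Proof.
move=> [C [s [s0 fC]]] f0 f1; have C0 := gauss_le_ge0 fC.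
exists (Num.max s (C * s ^+ 2)) => [|r]; first by rewrite lt_max s0.
rewrite ge_max => /andP[sr Cr]; have r0 : 0 < r by apply: lt_le_trans sr.
move=> i j; case ij: (i + j)%N => [|[|n]].
- have [-> ->] : i = 0%N /\ j = 0%N by lia.
  by rewrite f0 nanorm0 mulr1 invr_ge0 ltW.
- by rewrite expr1 mulVf ?gt_eqF // f1.
- apply: le_trans (fC i j) _; rewrite ij [r ^+ _]exprS mulKf ?gt_eqF //.
  rewrite [s ^+ _](exprD s 2%N n) mulrA [r ^+ _]exprS.
  apply: ler_pM; rewrite ?mulr_ge0 ?exprn_ge0 ?(ltW s0) //.
  by apply: lerXn2r; rewrite ?nnegrE // ltW.
Qed.

Lemma gauss_le_x r : 0 < r -> gauss_le v r^-1 r fps2_x.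
Proof.
move=> r0 i j; have b0 : 0 <= r^-1 * r ^+ (i + j) by rewrite mulr_ge0 ?invr_ge0 ?exprn_ge0 // ltW.
rewrite /fps2_x; case: andP => [[/eqP -> /eqP ->]|_]; last by rewrite nanorm0.
by rewrite nanorm1 expr1 mulVf ?gt_eqF.
Qed.

Lemma gauss_le_y r : 0 < r -> gauss_le v r^-1 r fps2_y.
Proof.
move=> r0 i j; have b0 : 0 <= r^-1 * r ^+ (i + j) by rewrite mulr_ge0 ?invr_ge0 ?exprn_ge0 // ltW.
rewrite /fps2_y; case: andP => [[/eqP -> /eqP ->]|_]; last by rewrite nanorm0.
by rewrite nanorm1 expr1 mulVf ?gt_eqF.
Qed.

Variables (t : K) (a b : nat).
Hypothesis t0 : t != 0.
Hypothesis t1 : v t < 1.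

Let l1 := t ^+ a.
Let l2 := t ^+ b.

Lemma nanorm_expr_neq m n : m != n -> v (t ^+ m) != v (t ^+ n).
Proof.
have vt0 : 0 < v t by rewrite nanorm_gt0.
by rewrite !nanormX; apply: contra_neq; apply: ieexprIn => //; rewrite lt_eqF.
Qed.

Lemma eigenvalue_monomial i j : l1 ^+ i * l2 ^+ j = t ^+ (a * i + b * j).
Proof. by rewrite -!exprM -exprD. Qed.

Lemma small_divisor_ge m n : m != n -> v (t ^+ n) <= v (t ^+ n - t ^+ m).
Proof.
move=> mn; rewrite nanormB_eq_max ?le_max ?lexx //.
by rewrite nanorm_expr_neq // eq_sym.
Qed.

Section Step.
Variable F : fmap2 K.
Hypothesis F0 : fixes_origin F.
Hypothesis Flin : agree 2 F (diag_map l1 l2).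

Definition normal_part w (z : fps2 K) := mask (resonant a b w) z.
Definition conj_part w (e z : fps2 K) := e + mask (nonresonant a b w) z.
Definition conjugator (z : fmap2 K) : fmap2 K :=
  (conj_part a fps2_x z.1, conj_part b fps2_y z.2).

(** The nonlinear part of the conjugacy equation: what remains of it once the
    terms linear in the unknown are removed. *)
Definition defect w e z P : fps2 K :=
  (fps2_comp (conj_part w e z) F - fps2_comp (conj_part w e z) (diag_map l1 l2))
  - (fps2_comp (normal_part w z) P - normal_part w z).

Definition correction w e z P : fps2 K := fun i j =>
  if (i + j < 2)%N then 0 else
  defect w e z P i j / (if (a * i + b * j == w)%N then 1 else t ^+ w - t ^+ (a * i + b * j)).

(** The unknown [z] collects the nonresonant coefficients of the conjugating map
    and the resonant coefficients of the normal form: each equation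
    of the conjugacy determines exactly one of them from those of lower degree. *)
Definition normal_step (z : fmap2 K) : fmap2 K :=
  (correction a fps2_x z.1 (conjugator z), correction b fps2_y z.2 (conjugator z)).

Lemma conjugator_agree z : agree 2 (conjugator z) fmap2_id.
Proof.
by split; rewrite /= /conj_part addrAC subrr add0r; apply: ord_ge2_nonresonant.
Qed.

Lemma fixes_origin_conjugator z : fixes_origin (conjugator z).
Proof.
by split; rewrite /= /conj_part fps2_coefD (@ord_ge2_nonresonant K a b) // addr0.
Qed.

Lemma diag0 : fixes_origin (diag_map l1 l2).
Proof. exact: fixes_origin_diag. Qed.

(** An unknown of degree [k] contributes to the defect in degrees larger than [k]
    only: in the first difference because [F] agrees with its linear part below
    degree 2, in the second one because [P] is tangent to the identity and the
    normal part has order 2. *)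
Lemma correction_contract w e z z' P P' n :
  fixes_origin P -> fixes_origin P' -> agree 2 P fmap2_id ->
  agree n P P' -> ord_ge n (z - z') ->
  ord_ge n.+1 (correction w e z P - correction w e z' P').
Proof.
move=> P0 P0' [Px Py] [PP1 PP2] zz.
suff D : ord_ge n.+1 (defect w e z P - defect w e z' P').
  move=> i j ij; rewrite fps2_coefB /correction; case: ifP => _; first by rewrite subrr.
  by rewrite -mulrBl -fps2_coefB D ?mul0r.
rewrite /defect; set c := conj_part w e z; set c' := conj_part w e z'.
set m := normal_part w z; set m' := normal_part w z'.
have cc : ord_ge n (c - c').
  rewrite /c /c' /conj_part opprD addrACA subrr add0r maskB.
  exact: ord_ge_mask.
have mm : ord_ge n (m - m') by rewrite /m /m' /normal_part maskB; apply: ord_ge_mask.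
rewrite (_ : _ - _ = (fps2_comp (c - c') F - fps2_comp (c - c') (diag_map l1 l2))
   - (fps2_comp (m - m') P - (m - m')) - (fps2_comp m' P - fps2_comp m' P')); last first.
  by rewrite !fps2_compB; ring.
have [F1 F2] := Flin.
apply: ord_geB; first apply: ord_geB.
- by apply: (@ord_geB_comp K 1%N n) => //; apply: diag0.
- rewrite -[X in _ - X]fps2_comp_id.
  by apply: (@ord_geB_comp K 1%N n).
- have m'2 : ord_ge 2 m' by apply: ord_ge2_resonant.
  case: n PP1 PP2 {zz cc mm} => [|n] PP1 PP2.
    by apply: ord_geB; apply: ord_ge_le (ord_ge_comp _ m'2).
  by rewrite -addn2; apply: (@ord_geB_comp K n 2%N).
Qed.

Lemma normal_step_contract n z z' : agree n z z' ->
  agree n.+1 (normal_step z) (normal_step z').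
Proof.
move=> [z1 z2].
have cz : agree n (conjugator z) (conjugator z').
  by split; rewrite /= /conj_part opprD addrACA subrr add0r maskB; apply: ord_ge_mask.
by split; apply: correction_contract => //;
  (exact: fixes_origin_conjugator || exact: conjugator_agree).
Qed.

(** In each degree the two sides of the conjugacy equation differ by the divisor
    times the unknown, minus the defect, and [correction] is the quotient of the
    defect by the divisor. *)
Lemma conj_of_correction w e z P : fixes_origin P -> agree 2 P fmap2_id ->
  ord_ge 1 e -> (forall i j, e i j != 0 -> (a * i + b * j = w)%N) ->
  correction w e z P = z ->
  t ^+ w *: conj_part w e z + fps2_comp (normal_part w z) P
    = fps2_comp (conj_part w e z) F.
Proof.
move=> P0 [Px Py] e1 ew zE; apply: fps2P => i j.
rewrite fps2_coefD fps2_coefZ.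
have -> : fps2_comp (normal_part w z) P i j =
    fps2_comp (conj_part w e z) F i j
    - fps2_comp (conj_part w e z) (diag_map l1 l2) i j
    + normal_part w z i j - defect w e z P i j.
  by rewrite /defect !fps2_coefB; ring.
rewrite fps2_comp_diag eigenvalue_monomial.
suff -> : defect w e z P i j =
    (t ^+ w - t ^+ (a * i + b * j)) * conj_part w e z i j + normal_part w z i j by ring.
have ew0 : (t ^+ w - t ^+ (a * i + b * j)) * e i j = 0.
  have [->|/ew ->] := eqVneq (e i j) 0; first by rewrite mulr0.
  by rewrite subrr mul0r.
rewrite /conj_part fps2_coefD mulrDr ew0 add0r /normal_part /mask /resonant /nonresonant.
have [ij|ij] := leqP 2 (i + j); last first.
  rewrite mulr0 addr0 /= /defect fps2_coefB.
  have [F1 F2] := Flin.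
  have c1 : ord_ge 1 (conj_part w e z).
    by apply: ord_geD e1 _; apply: ord_ge_le (@ord_ge2_nonresonant K a b w z).
  rewrite (ord_geB_comp (m := 1%N) F0 diag0 F1 F2 c1) // sub0r.
  rewrite -[X in _ - X]fps2_comp_id.
  have m2 : ord_ge 2 (normal_part w z) by apply: ord_ge2_resonant.
  rewrite (ord_geB_comp (m := 1%N) P0 _ Px Py m2) ?oppr0 //.
  exact: leq_trans ij _.
rewrite /=; have := congr1 (fun f : fps2 K => f i j) zE.
rewrite /correction /= ltnNge ij /=; case: eqVneq => [_|ne] <-.
  by rewrite divr1 mulr0 add0r.
rewrite addr0 mulrC divfK // subr_eq0.
by apply: contra_neq (nanorm_expr_neq ne) => ->.
Qed.

End Step.

(** The divisors [t ^+ w - t ^+ m], with [m] different from [w], have norm at least that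
    of [t ^+ w]: there are no small divisors, and the normalization converges. *)
Theorem analytic_normal_form (F : fmap2 K) :
  fixes_origin F -> geom_bounded2 v F -> has_diagonal_linear_part l1 l2 F ->
  exists P N, [/\ fixes_origin P /\ fixes_origin N, geom_bounded2 v P /\ geom_bounded2 v N,
    has_diagonal_linear_part 1 1 P /\ has_diagonal_linear_part l1 l2 N,
    homog2 a b N & fmap2_comp P F = fmap2_comp N P].
Proof.
move=> F0 [gF1 gF2] /diagonal_agree Flin; have [F1l F2l] := Flin.
have vt0 : 0 < v t by rewrite nanorm_gt0.
have vl n : v (t ^+ n) <= 1 by rewrite nanormX exprn_ile1 // ltW.
pose d := v (t ^+ (a + b)).
have d0 : 0 < d by rewrite nanorm_gt0 expf_neq0.
have d1 : d <= 1 by apply: vl.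
have da : d <= v (t ^+ a) by rewrite /d exprD nanormM ler_piMr ?nanorm_ge0.
have db : d <= v (t ^+ b) by rewrite /d exprD nanormM ler_piMl ?nanorm_ge0.
have lin (f e : fps2 K) n : ord_ge 2 (f - t ^+ n *: e) -> (forall i j, v (e i j) <= 1) ->
    forall i j, (i + j = 1)%N -> v (f i j) <= 1.
  move=> fe e1 i j ij; have /subr0_eq -> : f i j - (t ^+ n *: e) i j = 0.
    by rewrite -fps2_coefB fe ?ij.
  by rewrite fps2_coefZ nanormM mulr_ile1 ?nanorm_ge0.
have x1 i j : v ((fps2_x : fps2 K) i j) <= 1 by apply: nanorm_nat_le1.
have y1 i j : v ((fps2_y : fps2 K) i j) <= 1 by apply: nanorm_nat_le1.
have [s1 s10 F1s] := gauss_le_tangent gF1 (proj1 F0) (lin _ _ _ F1l x1).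
have [s2 s20 F2s] := gauss_le_tangent gF2 (proj2 F0) (lin _ _ _ F2l y1).
pose s := Num.max s1 s2; have s0 : 0 < s by rewrite lt_max s10.
have {}F1s : gauss_le v s^-1 s F.1 by apply: F1s; rewrite le_max lexx.
have {}F2s : gauss_le v s^-1 s F.2 by apply: F2s; rewrite le_max lexx orbT.
pose r := s / d; have r0 : 0 < r by rewrite divr_gt0.
have xr := gauss_le_x r0; have yr := gauss_le_y r0.
have xs := gauss_le_x s0; have ys := gauss_le_y s0.
have sZ n e : gauss_le v s^-1 s e -> gauss_le v s^-1 s (t ^+ n *: e).
  move=> es i j; rewrite fps2_coefZ nanormM; apply: le_trans (es i j).
  by rewrite ler_piMl ?nanorm_ge0.
(* Nonresonant coefficients may exceed the defect, of norm at most [r^-1 * d], by the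
   factor [d^-1] due to the divisors; resonant ones are coefficients of the
   defect, and their smallness is in turn what makes the defect small. *)
pose bnd w i j := (if (a * i + b * j == w)%N then r^-1 * d else r^-1) * r ^+ (i + j).
pose B w i j x := v x <= bnd w i j.
have bnd0 w i j : 0 <= bnd w i j.
  by rewrite /bnd mulr_ge0 ?exprn_ge0 ?(ltW r0) //; case: ifP => _; rewrite ?mulr_ge0 ?invr_ge0 // ltW.
have mask_nonres w (z : fps2 K) : (forall i j, B w i j (z i j)) ->
    gauss_le v r^-1 r (mask (nonresonant a b w) z).
  move=> zB i j; rewrite /mask /nonresonant.
  case: ifP => [/andP[_ /negbTE ij]|_]; last first.
    by rewrite nanorm0 mulr_ge0 ?exprn_ge0 ?invr_ge0 // ltW.
  by apply: le_trans (zB i j) _; rewrite /bnd ij.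
have mask_res w (z : fps2 K) : (forall i j, B w i j (z i j)) ->
    gauss_le v (r^-1 * d) r (mask (resonant a b w) z).
  move=> zB i j; rewrite /mask /resonant.
  case: ifP => [/andP[_ ij]|_]; last first.
    by rewrite nanorm0 !mulr_ge0 ?exprn_ge0 ?invr_ge0 // ltW.
  by apply: le_trans (zB i j) _; rewrite /bnd ij.
pose inv (z : fmap2 K) := forall i j, B a i j (z.1 i j) /\ B b i j (z.2 i j).
have conj_bound z : inv z ->
    gauss_le v r^-1 r (conjugator z).1 /\ gauss_le v r^-1 r (conjugator z).2.
  move=> zi; split; apply: gauss_leD => //; apply: mask_nonres => i j;
    by have [] := zi i j.
have defect_bound w e (z : fps2 K) P : gauss_le v r^-1 r e -> (forall i j, B w i j (z i j)) ->
    fixes_origin P -> agree 2 P fmap2_id -> gauss_le v r^-1 r P.1 -> gauss_le v r^-1 r P.2 ->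
    gauss_le v (r^-1 * d) r (defect F w e z P).
  move=> er zB P0 Pid P1 P2; apply: gauss_leB.
    apply: gauss_le_compB => //; rewrite ?d0 //; try exact: sZ.
    - exact: diag0.
    - by apply: gauss_leD => //; apply: mask_nonres.
  rewrite -[X in _ - X]fps2_comp_id.
  have := @gauss_le_compB (r^-1 * d) 1 r (normal_part w z) P fmap2_id.
  by rewrite divr1 mulr1; apply => //; [rewrite ltr01 lexx|apply: mask_res].
have corr_bound w e (z : fps2 K) P : gauss_le v r^-1 r e -> (forall i j, B w i j (z i j)) ->
    fixes_origin P -> agree 2 P fmap2_id -> gauss_le v r^-1 r P.1 -> gauss_le v r^-1 r P.2 ->
    d <= v (t ^+ w) -> forall i j, B w i j (correction F w e z P i j).
  move=> er zB P0 Pid P1 P2 dw i j.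
  have D := defect_bound w e z P er zB P0 Pid P1 P2 i j.
  rewrite /B /correction; case: ifP => _; first by rewrite nanorm0.
  rewrite /bnd; case: eqVneq => [_|ne]; first by rewrite divr1.
  rewrite nanormM nanormV ler_pdivrMr; last first.
    by rewrite (lt_le_trans d0) // (le_trans dw) // small_divisor_ge.
  apply: le_trans D _; rewrite mulrAC ler_wpM2l ?mulr_ge0 ?invr_ge0 ?exprn_ge0 ?(ltW r0) //.
  by apply: le_trans dw _; apply: small_divisor_ge.
have [|z zi|n z z' _ _|z [zi zE]] := @fmap2_fixpoint _ (normal_step F) (B a) (B b).
- by move=> i j; split; rewrite /B /= nanorm0.
- have [c1 c2] := conj_bound z zi.
  move=> i j; split; apply: corr_bound => //;
    by [move=> k l; have [] := zi k l|apply: fixes_origin_conjugator|apply: conjugator_agree].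
- exact: normal_step_contract.
have c0 := fixes_origin_conjugator z; have cid := conjugator_agree z.
have [c1 c2] := conj_bound z zi.
pose N : fmap2 K := (l1 *: fps2_x + normal_part a z.1, l2 *: fps2_y + normal_part b z.2).
have z1 i j : B a i j (z.1 i j) by have [] := zi i j.
have z2 i j : B b i j (z.2 i j) by have [] := zi i j.
exists (conjugator z), N; split.
- split => //; split; rewrite /= fps2_coefD fps2_coefZ mulr0 add0r;
    exact: ord_ge2_resonant.
- split; first by split; exists r^-1, r.
  split; apply: geom_boundedD; try (apply: geom_boundedZ).
  + exact: geom_bounded_x.
  + by exists (r^-1 * d), r; split => //; apply: mask_res.
  + exact: geom_bounded_y.
  + by exists (r^-1 * d), r; split => //; apply: mask_res.
- split; first by apply/diagonal_agree; rewrite diag_map1.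
  by apply/diagonal_agree; split; rewrite /= addrAC subrr add0r; apply: ord_ge2_resonant.
- split=> i j ij; rewrite /= fps2_coefD fps2_coefZ /normal_part /mask /resonant (negbTE ij) andbF addr0.
    move: ij; case: i j => [|[|i]] [|j]; rewrite /fps2_x /= ?mulr0 //.
    by rewrite muln1 muln0 addn0 eqxx.
  move: ij; case: i j => [|i] [|[|j]]; rewrite /fps2_y /= ?mulr0 //.
  by rewrite muln1 muln0 add0n eqxx.
- have z1E : correction F a fps2_x z.1 (conjugator z) = z.1 by rewrite -{3}zE.
  have z2E : correction F b fps2_y z.2 (conjugator z) = z.2 by rewrite -{3}zE.
  have xw i j : (fps2_x : fps2 K) i j != 0 -> (a * i + b * j = a)%N.
    by case: i j => [|[|i]] [|j]; rewrite /fps2_x /= ?eqxx // muln1 muln0 addn0.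
  have yw i j : (fps2_y : fps2 K) i j != 0 -> (a * i + b * j = b)%N.
    by case: i j => [|i] [|[|j]]; rewrite /fps2_y /= ?eqxx // muln1 muln0 add0n.
  have x1' : ord_ge 1 (fps2_x : fps2 K) by apply: ord_ge1.
  have y1' : ord_ge 1 (fps2_y : fps2 K) by apply: ord_ge1.
  congr (_, _); rewrite [RHS]fps2_compD fps2_compZ.
    by rewrite fps2_comp_x //; exact: esym (conj_of_correction F0 Flin c0 cid x1' xw z1E).
  by rewrite fps2_comp_y //; exact: esym (conj_of_correction F0 Flin c0 cid y1' yw z2E).
Qed.

(** A nonresonant term of lowest degree would be multiplied by two different
    factors, [t ^+ m] and [t ^+ w], on the two sides of the conjugacy equation. *)
Theorem conj_normal_forms_homog (P N N' : fmap2 K) :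
  fixes_origin P -> fixes_origin N -> fixes_origin N' ->
  has_diagonal_linear_part l1 l2 N -> has_diagonal_linear_part l1 l2 N' ->
  homog2 a b N -> homog2 a b N' ->
  fmap2_comp P N = fmap2_comp N' P -> homog2 a b P.
Proof.
move=> P0 N0 N0' /diagonal_agree Nl /diagonal_agree Nl' [Nh1 Nh2] [Nh1' Nh2'] PN.
pose res w (f : fps2 K) := mask (fun i j => (a * i + b * j == w)%N) f.
pose S : fmap2 K := (res a P.1, res b P.2).
have resh w (f : fps2 K) : homog a b w (res w f).
  by move=> i j /negbTE ij; rewrite /res /mask ij.
have S0 : fixes_origin S.
  by case: P0 => P1 P2; split; rewrite /= /res /mask; case: ifP.
have step w (p n' : fps2 K) m :
    fps2_comp p N = t ^+ w *: p + fps2_comp n' P ->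
    ord_ge 2 n' -> homog a b w n' -> agree m.+1 P S -> ord_ge m.+1 (p - res w p) ->
    ord_ge m.+2 (p - res w p).
  move=> E n'2 n'h [PS1 PS2] pm i j ij.
  have [ij'|ij'] := ltnP (i + j) m.+1; first exact: pm.
  have [ijw|ijw] := eqVneq (a * i + b * j)%N w.
    by rewrite fps2_coefB /res /mask ijw eqxx subrr.
  have Ec := congr1 (fun f : fps2 K => f i j) E.
  move: Ec; rewrite -{1}[p](subrK (res w p)) fps2_compD !fps2_coefD.
  rewrite (homog_comp (resh w p) Nh1 Nh2 ijw) addr0.
  have -> : fps2_comp n' P i j = 0.
    rewrite -(subrK (fps2_comp n' S) (fps2_comp n' P)) fps2_coefD.
    rewrite (@ord_geB_comp K m 2%N) ?addn2 //.
    by rewrite (homog_comp n'h _ _ ijw) ?addr0 //; apply: resh.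
  have -> : fps2_comp (p - res w p) N i j = t ^+ (a * i + b * j) * (p - res w p) i j.
    have [Nl1 Nl2] := Nl.
    have /subr0_eq -> : fps2_comp (p - res w p) N i j
        - fps2_comp (p - res w p) (diag_map l1 l2) i j = 0.
      rewrite -fps2_coefB.
      by apply: (ord_geB_comp (m := 1%N) N0 _ Nl1 Nl2 pm) => //; apply: fixes_origin_diag.
    by rewrite fps2_comp_diag eigenvalue_monomial.
  have -> : (t ^+ w *: p) i j = t ^+ w * (p - res w p) i j.
    by rewrite fps2_coefZ fps2_coefB /res /mask (negbTE ijw) subr0.
  rewrite addr0 => /eqP; rewrite -subr_eq0 -mulrBl mulf_eq0 => /orP[|/eqP //].
  rewrite subr_eq0 => /eqP e; have := nanorm_expr_neq ijw; by rewrite e eqxx.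
have [PN1 PN2] : fps2_comp P.1 N = fps2_comp N'.1 P /\ fps2_comp P.2 N = fps2_comp N'.2 P.
  by split; [have := congr1 fst PN|have := congr1 snd PN].
have [Nl1 Nl2] := Nl'.
have E1 : fps2_comp P.1 N = t ^+ a *: P.1 + fps2_comp (N'.1 - l1 *: fps2_x) P.
  by rewrite PN1 fps2_compB fps2_compZ fps2_comp_x // addrC subrK.
have E2 : fps2_comp P.2 N = t ^+ b *: P.2 + fps2_comp (N'.2 - l2 *: fps2_y) P.
  by rewrite PN2 fps2_compB fps2_compZ fps2_comp_y // addrC subrK.
have nh1 : homog a b a (N'.1 - l1 *: fps2_x).
  move=> i j ij; rewrite fps2_coefB fps2_coefZ Nh1' // sub0r.
  move: ij; case: i j => [|[|i]] [|j]; rewrite /fps2_x /= ?mulr0 ?oppr0 //.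
  by rewrite muln1 muln0 addn0 eqxx.
have nh2 : homog a b b (N'.2 - l2 *: fps2_y).
  move=> i j ij; rewrite fps2_coefB fps2_coefZ Nh2' // sub0r.
  move: ij; case: i j => [|i] [|[|j]]; rewrite /fps2_y /= ?mulr0 ?oppr0 //.
  by rewrite muln1 muln0 add0n eqxx.
have PS m : agree m.+1 P S.
  elim: m => [|m [PS1 PS2]].
    by split; apply: ord_ge1; rewrite fps2_coefB (proj1 P0, proj2 P0) (proj1 S0, proj2 S0) subr0.
  by split; [apply: (step _ _ _ _ E1)|apply: (step _ _ _ _ E2)].
have -> : P = S by apply: agree_eq => n; apply: agree_le (PS n).
by split; apply: resh.
Qed.

End Normalization.

(** * Norms of factorials *)

Section Factorial.
Context {R : realType} {K : fieldType} (v : nonarch_norm R K).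
Hypothesis K0 : [pchar K] =i pred0.

Lemma nanorm_nat_gt0 n : (0 < n)%N -> 0 < v n%:R.
Proof. by rewrite nanorm_gt0 (proj1 (pcharf0P K) K0) lt0n. Qed.

(** Legendre's formula bounds the exponent by [n / p + n / p ^ 2 + ...], and each
    quotient is at most half of the previous one. *)
Lemma logn_fact_le p n : prime p -> (logn p n`! <= n)%N.
Proof.
move=> p_pr; rewrite logn_fact // big_add1 /=.
have p1 := prime_gt1 p_pr.
suff H m : (\sum_(0 <= k < m) n %/ p ^ k.+1 + n %/ p ^ m <= n)%N.
  by apply: leq_trans (H n); apply: leq_addr.
elim: m => [|m IH]; first by rewrite big_geq // add0n expn0 divn1.
apply: leq_trans IH; rewrite big_nat_recr //= -addnA leq_add2l.
rewrite expnSr divnMA addnn -muln2.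
by apply: leq_trans (leq_trunc_div _ p); rewrite leq_mul2l p1 orbT.
Qed.

(** By Bezout a number prime to a prime of norm less than 1 has norm 1. So the
    norm of [n`!] is a power of the norm of that prime, with exponent at most [n]. *)
Lemma nanorm_fact_ge : exists2 c, 0 < c <= 1 & forall n, c ^+ n <= v n`!%:R.
Proof.
have [[p [p_pr vp]]|allp] := pselect (exists p, prime p /\ v p%:R < 1); last first.
  exists 1; first by rewrite ltr01 lexx.
  have v1 n : (0 < n)%N -> v n%:R = 1.
    have [m] := ubnP n; elim: m n => // m IH n; rewrite ltnS => nm n0.
    have [n1|n1] := leqP n 1.
      by have -> : n = 1%N by [lia]; rewrite nanorm1.
    have p_pr := pdiv_prime n1; have p_dvd := pdiv_dvd n.
    have vp : v (pdiv n)%:R = 1.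
      apply/eqP; rewrite eq_le nanorm_nat_le1 leNgt; apply/negP => vp.
      by apply: allp; exists (pdiv n).
    rewrite -(divnK p_dvd) natrM nanormM vp mulr1; apply: IH; last first.
      by rewrite divn_gt0 ?pdiv_gt0 // dvdn_leq.
    apply: leq_trans nm; rewrite ltn_Pdiv // prime_gt1 //.
  by move=> n; rewrite expr1n v1 // fact_gt0.
have p0 : 0 < v p%:R by rewrite nanorm_nat_gt0 // prime_gt0.
have coprime1 q : coprime p q -> v q%:R = 1.
  move=> pq; have [a _] := Bezoutl q (prime_gt0 p_pr).
  rewrite (eqP pq) => /dvdnP[w E].
  have : v (1 + (a * q)%:R) < 1.
    rewrite -[1]/(1%:R) -natrD E natrM nanormM; apply: le_lt_trans vp.
    by rewrite ler_piMl ?nanorm_ge0 ?nanorm_nat_le1.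
  move=> lt1; apply/eqP; rewrite eq_le nanorm_nat_le1 leNgt; apply/negP => vq.
  have vaq : v (a * q)%:R < v 1.
    rewrite nanorm1 natrM nanormM; apply: le_lt_trans vq.
    by rewrite ler_piMl ?nanorm_ge0 ?nanorm_nat_le1.
  by move: lt1; rewrite addrC nanormD_eq // nanorm1 ltxx.
exists (v p%:R) => [|n]; first by rewrite p0 ltW.
rewrite -(partnC p (fact_gt0 n)) natrM nanormM p_part natrX nanormX.
rewrite [v (_`__)%:R]coprime1 ?mulr1.
  by apply: ler_wiXn2l; rewrite ?nanorm_ge0 ?(ltW vp) // logn_fact_le.
by rewrite (@pnat_coprime p) ?part_pnat // pnat_id.
Qed.

Lemma nanorm_factD m n p : (m + n <= p)%N -> v p`!%:R <= v m`!%:R * v n`!%:R.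
Proof.
move=> mnp; have le k l : v (k + l)`!%:R <= v k`!%:R * v l`!%:R.
  rewrite -(bin_fact (leq_addr l k)) addKn 2!natrM 2!nanormM.
  by rewrite ler_piMl ?mulr_ge0 ?nanorm_ge0 ?nanorm_nat_le1.
rewrite -(subnK mnp); apply: le_trans (le _ _) _; apply: le_trans (le m n).
by rewrite ler_piMl ?nanorm_ge0 ?nanorm_nat_le1.
Qed.

End Factorial.

(** * Recursions with integer divisors *)

Section Majorant.
Context {R : realType} {K : fieldType} (v : nonarch_norm R K).

Lemma fps2_coefM_row (f g : fps2 K) n :
  (f * g) n 0%N = \sum_(k < n.+1) f k 0%N * g (n - k)%N 0%N.
Proof. by rewrite fps2_coefM; apply: eq_bigr => k _; rewrite big_ord1 subnn. Qed.

Lemma fps2_coefX_row0 (f : fps2 K) i : (f ^+ i) 0%N 0%N = f 0%N 0%N ^+ i.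
Proof.
elim: i => [|i IH]; first by rewrite !expr0 fps2_coef1.
by rewrite !exprS fps2_coefM_row big_ord1 IH.
Qed.

(** A coefficient of a power depends on the last coefficient of the base through
    its derivative; the rest of it is quadratic in the coefficients other than
    the constant one, whence the factor [e ^+ 2]. Products of two weights [W] are
    bounded by the smaller weight [W'], in which the last divisor is missing. *)
Lemma coef_exp_linear_part (U : fps2 K) (W W' : nat -> R) M e n :
  (forall a, 0 <= W a) -> (forall a, W' a <= W a) ->
  (forall a b, (0 < a)%N -> (0 < b)%N -> W a * W b <= W' (a + b)%N) ->
  (forall a, (0 < a)%N -> 0 <= W' a) ->
  1 <= M -> v (U 0%N 0%N) <= M -> 0 <= e <= 1 ->
  (forall a, (0 < a < n)%N -> v (U a 0%N) <= e * W a) ->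
  forall i b, (0 < b <= n)%N ->
    v ((U ^+ i) b 0%N - i%:R * U 0%N 0%N ^+ i.-1 * U b 0%N) <= M ^+ i * e ^+ 2 * W' b
    /\ ((b < n)%N -> v ((U ^+ i) b 0%N) <= M ^+ i * e * W b).
Proof.
move=> W0 W'W WW W'0 M1 UM /andP[e0 e1] UW.
have M0 : 0 <= M by apply: le_trans M1.
elim=> [|i IH] b bn.
  have b0 : (0 < b)%N by case/andP: bn.
  rewrite expr0 fps2_coef1 gtn_eqF // !mul0r subr0 nanorm0.
  by split; rewrite ?mulr_ge0 ?exprn_ge0 ?W'0.
have b0 : (0 < b)%N by case/andP: bn.
have bnd0 : 0 <= M ^+ i.+1 * e ^+ 2 * W' b by rewrite !mulr_ge0 ?exprn_ge0 ?W'0.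
have H : v ((U ^+ i.+1) b 0%N - i.+1%:R * U 0%N 0%N ^+ i.+1.-1 * U b 0%N)
    <= M ^+ i.+1 * e ^+ 2 * W' b.
  case: b bn b0 bnd0 => // b bn _ bnd0.
  have -> : (U ^+ i.+1) b.+1 0%N - i.+1%:R * U 0%N 0%N ^+ i.+1.-1 * U b.+1 0%N =
      U 0%N 0%N * ((U ^+ i) b.+1 0%N - i%:R * U 0%N 0%N ^+ i.-1 * U b.+1 0%N)
      + \sum_(k < b) U k.+1 0%N * (U ^+ i) (b - k)%N 0%N.
    rewrite exprS fps2_coefM_row big_ord_recl big_ord_recr /= subn0 subnn.
    rewrite fps2_coefX_row0.
    have -> : \sum_(k < b) U (lift ord0 (widen_ord (leqnSn b) k)) 0%N
          * (U ^+ i) (b.+1 - lift ord0 (widen_ord (leqnSn b) k))%N 0%N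
        = \sum_(k < b) U k.+1 0%N * (U ^+ i) (b - k)%N 0%N.
      by apply: eq_bigr => k _; rewrite /= /bump /= add1n subSS.
    rewrite mulrBr [U 0%N 0%N * (i%:R * _ * _)]mulrC.
    have -> : i%:R * U 0%N 0%N ^+ i.-1 * U b.+1 0%N * U 0%N 0%N = i%:R * U 0%N 0%N ^+ i * U b.+1 0%N.
      by case: i {IH bnd0} => [|i]; rewrite ?mul0r //= exprS; ring.
    rewrite /bump /= add1n -natr1; move: (\sum_(k < b) _) => x.
    move: (U 0%N 0%N ^+ i) ((U ^+ i) b.+1 0%N) (U b.+1 0%N) (U 0%N 0%N) (i%:R : K).
    by move=> z1 z2 z3 z4 y; ring.
  apply: nanormD_le.
    rewrite nanormM (_ : M ^+ i.+1 * _ * _ = M * (M ^+ i * e ^+ 2 * W' b.+1)).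
      by apply: ler_pM; rewrite ?nanorm_ge0 //; have [] := IH _ bn.
    by rewrite exprS; ring.
  apply: nanorm_sum_le => // k _; rewrite nanormM.
  have [_ Ik] := IH (b - k)%N ltac:(by have := ltn_ord k; lia).
  apply: (@le_trans _ _ ((e * W k.+1) * (M ^+ i * e * W (b - k)%N))).
    apply: ler_pM; rewrite ?nanorm_ge0 //.
      by apply: UW; have := ltn_ord k; lia.
    by apply: Ik; have := ltn_ord k; lia.
  rewrite (_ : _ * _ = M ^+ i * e ^+ 2 * (W k.+1 * W (b - k)%N)); last by ring.
  have -> : b.+1 = (k.+1 + (b - k))%N by have := ltn_ord k; lia.
  apply: ler_pM; rewrite ?mulr_ge0 ?exprn_ge0 //.
    by rewrite ler_wpM2r ?exprn_ge0 // ler_weXn2l.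
  by apply: WW => //; have := ltn_ord k; lia.
split=> // b_n.
rewrite -[(U ^+ _) b 0%N](subrK (i.+1%:R * U 0%N 0%N ^+ i.+1.-1 * U b 0%N)).
apply: nanormD_le.
  apply: le_trans H _; apply: ler_pM; rewrite ?mulr_ge0 ?exprn_ge0 ?W'0 //.
  by rewrite ler_wpM2l ?exprn_ge0 // expr2 ler_piMl.
rewrite !nanormM nanormX -mulrA.
apply: (@le_trans _ _ (1 * (M ^+ i * (e * W b)))).
  apply: ler_pM; rewrite ?nanorm_nat_le1 ?mulr_ge0 ?exprn_ge0 ?nanorm_ge0 //.
  apply: ler_pM; rewrite ?exprn_ge0 ?nanorm_ge0 //.
    by apply: lerXn2r; rewrite ?nnegrE ?nanorm_ge0.
  by apply: UW; lia.
rewrite mul1r mulrA -[leRHS]mulrA [leRHS]mulrA; apply: ler_pM => //.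
- by rewrite mulr_ge0 ?exprn_ge0.
- by rewrite ler_wpM2r // ler_weXn2l.
Qed.

End Majorant.

Section MajorantThm.
Context {R : realType} {K : fieldType} (v : nonarch_norm R K).
Hypothesis K0 : [pchar K] =i pred0.

(** The weights [inv_fact] absorb the divisors [n - p]. For [0 < p] they satisfy a
    supermultiplicativity that is strict by one step ([inv_factM]), which leaves
    room for the next divisor. *)
Section InvFact.
Variable p : nat.
Hypothesis p0 : (0 < p)%N.

Definition inv_fact n : R := (v (n - p)`!%:R)^-1.

Lemma nanorm_fact_gt0 n : 0 < v n`!%:R.
Proof. by rewrite nanorm_nat_gt0 // fact_gt0. Qed.

Lemma inv_fact_ge0 n : 0 <= inv_fact n.
Proof. by rewrite invr_ge0 nanorm_ge0. Qed.

Lemma inv_fact_ge1 n : 1 <= inv_fact n.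
Proof. by rewrite invf_ge1 ?nanorm_nat_le1 // nanorm_fact_gt0. Qed.

Lemma inv_fact_le m n : (m <= n)%N -> inv_fact m <= inv_fact n.
Proof.
move=> mn; rewrite lef_pV2 ?posrE ?nanorm_fact_gt0 //.
apply: le_trans (nanorm_factD v (m := m - p) (n := 0) _) _; last first.
  by rewrite ler_piMr ?nanorm_ge0 ?nanorm_nat_le1.
by rewrite addn0 leq_sub2r.
Qed.

Lemma inv_factM a b : (0 < a)%N -> (0 < b)%N ->
  inv_fact a * inv_fact b <= inv_fact (a + b).-1.
Proof.
move=> a0 b0; rewrite -invfM lef_pV2 ?posrE ?mulr_gt0 ?nanorm_fact_gt0 //.
by apply: nanorm_factD; lia.
Qed.

Lemma inv_factS n : (p < n)%N -> inv_fact n.-1 = v (n - p)%:R * inv_fact n.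
Proof.
case: n => // n; rewrite ltnS /= => pn; rewrite /inv_fact subSn // factS natrM nanormM.
by rewrite invfM mulVKf // gt_eqF // nanorm_nat_gt0.
Qed.

Lemma inv_fact_small n : (n <= p)%N -> inv_fact n = 1.
Proof. by rewrite -subn_eq0 /inv_fact => /eqP ->; rewrite nanorm1 invr1. Qed.

End InvFact.

(** The row [u n = U n 0] satisfies a recursion in which [u n] comes with a
    divisor at least [d * v (n - p)], so that its size grows at most like a geometric
    sequence divided by a factorial; in a field of characteristic 0 the inverses
    of factorials grow geometrically. The bound [e * r ^+ n / v (n - p)`!] is
    proved by induction: [e] small absorbs the terms of the leading power
    that are quadratic in [u], and [r] large absorbs all the others. *)
Theorem majorant (U : fps2 K) (g : nat -> K) (A : nat -> nat -> K) (B L : nat -> K)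
    (k p : nat) (C s d : R) :
  (0 < p)%N -> 0 < s -> 0 < d ->
  (forall i, v (g i) <= C * s ^+ i) ->
  (forall n a, (a < n)%N -> v (A n a) <= C * s ^+ (n - a)) ->
  (forall n, v (B n) <= C * s ^+ n) ->
  (forall n, (p < n)%N ->
    d * v (n - p)%:R <= v (g k.+1 * k.+1%:R * U 0%N 0%N ^+ k - L n)) ->
  (forall n, (p < n)%N ->
    \sum_(q < n.+1) g (k.+1 + q)%N * (U ^+ (k.+1 + q)) (n - q)%N 0%N =
      L n * U n 0%N + \sum_(a < n) A n a * U a 0%N + B n) ->
  exists C' r, 0 < r /\ forall n, v (U n 0%N) <= C' * r ^+ n.
Proof.
move=> p0 s0 d0 gC AC BC Dd eqn.
wlog [C1 s1] : C s s0 gC AC BC / 1 <= C /\ 1 <= s.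
  move=> wl; have C0 : 0 <= C by have := le_trans (nanorm_ge0 v _) (gC 0%N); rewrite mulr1.
  have up n : C * s ^+ n <= Num.max 1 C * Num.max 1 s ^+ n.
    apply: ler_pM; rewrite ?exprn_ge0 ?(ltW s0) ?le_max ?lexx ?orbT //.
    by apply: lerXn2r; rewrite ?nnegrE ?le_max ?lexx ?(ltW s0) ?orbT ?ler01.
  apply: (wl (Num.max 1 C) (Num.max 1 s)).
  - by rewrite lt_max s0 orbT.
  - by move=> i; apply: le_trans (gC i) (up _).
  - by move=> n a an; apply: le_trans (AC n a an) (up _).
  - by move=> n; apply: le_trans (BC n) (up _).
  - by rewrite !le_max !lexx.
have C0 : 0 < C by apply: lt_le_trans C1.
pose u n := U n 0%N.
pose M := 1 + v (u 0%N).
have M1 : 1 <= M by rewrite lerDl nanorm_ge0.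
have M0 : 0 < M by apply: lt_le_trans M1.
have uM : v (u 0%N) <= M by rewrite lerDr.
pose S := s * M; have S0 : 0 < S by rewrite mulr_gt0.
have sS : s <= S by rewrite ler_peMr // ltW.
have MS : M <= S by rewrite ler_peMl // ltW.
have S1 : 1 <= S by apply: le_trans sS.
pose H := C * S ^+ k.+1; have H0 : 0 < H by rewrite mulr_gt0 // exprn_gt0.
have CH : C <= H by rewrite ler_peMr ?(ltW C0) // exprn_ege1.
have CMH : C * M <= H.
  by rewrite ler_pM2l // exprS; apply: le_trans MS _; rewrite ler_peMr ?(ltW S0) // exprn_ege1.
(* [e] makes the quadratic terms of the leading power smaller than [d * e];
   [Y] makes all other terms so, each of them having a factor [(S / r) ^+ q] with [0 < q];
   [X] accounts for the initial coefficients. *)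
pose e := Num.min 1 (d / H).
have e0 : 0 < e by rewrite lt_min ltr01 divr_gt0.
have e1 : e <= 1 by rewrite ge_min lexx.
have He : H * e <= d by rewrite mulrC -ler_pdivlMr // ge_min lexx orbT.
have de0 : 0 < d * e by rewrite mulr_gt0.
pose Y := 1 + H / (d * e).
have Y1 : 1 <= Y by rewrite lerDl divr_ge0 // ltW.
have Y0 : 0 < Y by apply: lt_le_trans Y1.
pose X := 1 + \sum_(a < p.+1) v (u a) / e.
have X1 : 1 <= X.
  by rewrite lerDl; apply: sumr_ge0 => a _; rewrite divr_ge0 ?nanorm_ge0 // ltW.
have X0 : 0 < X by apply: lt_le_trans X1.
pose r := S * Y * X.
have r0 : 0 < r by rewrite !mulr_gt0.
have SY1 : 1 <= S * Y by rewrite mulr_ege1.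
have r1 : 1 <= r by rewrite mulr_ege1.
have SYr : S * Y <= r by rewrite ler_peMr // ltW // (lt_le_trans ltr01).
have key q : (0 < q)%N -> H * S ^+ q <= d * e * r ^+ q.
  case: q => // q _; apply: (@le_trans _ _ (d * e * (S * Y) ^+ q.+1)); last first.
    by rewrite ler_pM2l //; apply: lerXn2r => //; rewrite nnegrE ltW // mulr_gt0.
  rewrite [(S * Y) ^+ _]exprMn [S ^+ _ * _]mulrC mulrA ler_pM2r ?exprn_gt0 //.
  apply: (@le_trans _ _ (d * e * Y)).
    rewrite mulrDr mulr1 mulrCA mulfV ?gt_eqF // mulr1 lerDr ltW //.
  by rewrite ler_pM2l // exprS ler_peMr ?(ltW Y0) // exprn_ege1.
pose t := inv_fact p.
have t_ge1 n : 1 <= t n by apply: inv_fact_ge1.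
have t_ge0 n : 0 <= t n by apply: inv_fact_ge0.
pose W n := r ^+ n * t n; pose W' n := r ^+ n * t n.-1.
have rX n : 0 <= r ^+ n by rewrite exprn_ge0 // ltW.
have rX0 n : 0 < r ^+ n by rewrite exprn_gt0.
have W0 n : 0 <= W n by rewrite mulr_ge0.
have W'0 n : 0 <= W' n by rewrite mulr_ge0.
have W'W n : W' n <= W n by rewrite ler_wpM2l // inv_fact_le // leq_pred.
have W'1 n : r ^+ n <= W' n by rewrite ler_peMr.
have WW a b : (0 < a)%N -> (0 < b)%N -> W a * W b <= W' (a + b)%N.
  by move=> a0 b0; rewrite /W mulrACA -exprD ler_wpM2l // inv_factM.
have uW n : (0 < n)%N -> v (u n) <= e * W n.
  elim/ltn_ind: n => n IH n0.
  have [np|pn] := leqP n p.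
    rewrite /W /t inv_fact_small // mulr1.
    have uX : v (u n) / e <= X.
      have np' : (n < p.+1)%N by [].
      rewrite /X (bigD1 (Ordinal np')) //= addrA ler_wpDr //.
        by apply: sumr_ge0 => a _; rewrite divr_ge0 ?nanorm_ge0 // ltW.
      by rewrite lerDr.
    rewrite -ler_pdivrMl // mulrC; apply: le_trans uX _.
    apply: (@le_trans _ _ r); first by rewrite ler_peMl // ltW.
    by case: n n0 {IH np} => // n _; rewrite exprS ler_peMr ?(ltW r0) // exprn_ege1.
  have np0 : 0 < v (n - p)%:R by rewrite nanorm_nat_gt0 // subn_gt0.
  have e01 : 0 <= e <= 1 by rewrite ltW.
  have UW a : (0 < a < n)%N -> v (U a 0%N) <= e * W a.
    by move=> /andP[a0 an]; apply: IH.
  have lin := coef_exp_linear_part W0 W'W WW (fun a _ => W'0 a) M1 uM e01 UW.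
  pose D := g k.+1 * k.+1%:R * u 0%N ^+ k - L n.
  pose rem := (U ^+ k.+1) n 0%N - k.+1%:R * u 0%N ^+ k * u n.
  have E : D * u n = \sum_(a < n) A n a * u a + B n - g k.+1 * rem
      - \sum_(q < n) g (k.+1 + q.+1)%N * (U ^+ (k.+1 + q.+1)) (n - q.+1)%N 0%N.
    have := eqn n pn; rewrite big_ord_recl /= addn0 subn0.
    rewrite (eq_bigr (fun q : 'I_n => g (k.+1 + q.+1)%N * (U ^+ (k.+1 + q.+1)) (n - q.+1)%N 0%N)) //.
    rewrite /D /rem /u; move: (\sum_(q < n) _) (\sum_(a < n) _) => x y.
    move: ((U ^+ k.+1) n 0%N) (U n 0%N) (U 0%N 0%N ^+ k) (k.+1%:R : K) => z1 z2 z3 z4 eq1.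
    have -> : y = L n * z2 + x + B n - g k.+1 * z1 by rewrite -eq1; ring.
    by ring.
  have bound : v (D * u n) <= d * (e * W' n).
    have de' : 0 <= d * (e * W' n) by rewrite !mulr_ge0 // ltW.
    have geo C' q : 0 <= C' -> C' <= H -> (0 < q <= n)%N -> C' * S ^+ q * r ^+ (n - q) <= d * (e * W' n).
      move=> C'0 C'H /andP[q0 qn].
      apply: (@le_trans _ _ (H * S ^+ q * r ^+ (n - q))).
        by rewrite ler_wpM2r // ler_wpM2r // exprn_ge0 // ltW.
      apply: (@le_trans _ _ (d * e * r ^+ q * r ^+ (n - q))).
        by rewrite ler_wpM2r // key.
      by rewrite -mulrA -exprD subnKC // -mulrA ler_wpM2l ?(ltW d0) // ler_wpM2l ?(ltW e0).
    have sSn q : s ^+ q <= S ^+ q by apply: lerXn2r => //; rewrite nnegrE ltW.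
    rewrite E; apply: nanormB_le; first (apply: nanormB_le; first apply: nanormD_le).
    - apply: nanorm_sum_le => // a _; rewrite nanormM.
      have an := ltn_ord a.
      case: (posnP a) => [a0|a0].
        rewrite a0; apply: le_trans (geo (C * M) n _ _ _); rewrite ?mulr_ge0 ?(ltW C0) ?(ltW M0) // ?n0 ?leqnn //.
        rewrite subnn mulr1 mulrAC; apply: ler_pM; rewrite ?nanorm_ge0 //.
        apply: le_trans (AC n 0%N n0) _; rewrite subn0 ler_pM2l //.
      apply: (@le_trans _ _ ((C * S ^+ (n - a)) * (e * W a))).
        apply: ler_pM; rewrite ?nanorm_ge0 //; last by apply: UW; rewrite a0.
        by apply: le_trans (AC n a an) _; rewrite ler_pM2l.
      apply: (@le_trans _ _ (d * e * r ^+ (n - a) * (e * W a))).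
        rewrite ler_wpM2r ?mulr_ge0 ?(ltW e0) //.
        apply: le_trans (key (n - a)%N _); last by rewrite subn_gt0.
        by rewrite ler_wpM2r // exprn_ge0 // ltW.
      rewrite (_ : _ * _ = d * (e * (e * (r ^+ (n - a) * r ^+ a * t a)))); last by rewrite /W; ring.
      rewrite -exprD subnK ?(ltnW an) // ler_pM2l // ler_pM2l //.
      apply: (@le_trans _ _ (r ^+ n * t a)).
        by rewrite ler_piMl // mulr_ge0.
      by rewrite ler_wpM2l // inv_fact_le // -ltnS prednK.
    - apply: le_trans (geo C n _ _ _); rewrite ?(ltW C0) // ?n0 ?leqnn //.
      by rewrite subnn mulr1; apply: le_trans (BC n) _; rewrite ler_pM2l.
    - have [rem_le _] := lin k.+1 n ltac:(by rewrite n0 leqnn).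
      rewrite nanormM; apply: le_trans (ler_pM (nanorm_ge0 _ _) (nanorm_ge0 _ _) (gC _) rem_le) _.
      rewrite [leLHS](_ : _ = H * e * (e * W' n)); last first.
        by rewrite /H /S [(s * M) ^+ _]exprMn; ring.
      by rewrite ler_wpM2r // mulr_ge0 // ltW.
    - apply: nanorm_sum_le => // q _; rewrite nanormM; have qn := ltn_ord q.
      have gS : v (g (k.+1 + q.+1)%N) * M ^+ (k.+1 + q.+1) <= H * S ^+ q.+1.
        apply: (@le_trans _ _ (C * s ^+ (k.+1 + q.+1) * M ^+ (k.+1 + q.+1))).
          by rewrite ler_wpM2r // exprn_ge0 // ltW.
        by rewrite -mulrA -exprMn exprD mulrA.
      have [nq|nq] := leqP n q.+1.
        have nE : n = q.+1 by apply/eqP; rewrite eqn_leq nq.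
        rewrite [X in (U ^+ _) X](_ : _ = 0%N); last by rewrite [X in (X - _)%N]nE subnn.
        rewrite [X in W' X]nE.
        rewrite fps2_coefX_row0 nanormX.
        apply: (@le_trans _ _ (H * S ^+ q.+1)).
          apply: le_trans gS; rewrite ler_wpM2l ?nanorm_ge0 //.
          by apply: lerXn2r; rewrite ?nnegrE ?nanorm_ge0 // ltW.
        apply: le_trans (key q.+1 _) _ => //.
        by rewrite -mulrA ler_pM2l // ler_pM2l.
      have nq0 : (0 < n - q.+1 <= n)%N by rewrite subn_gt0 nq leq_subr.
      have nqn : (n - q.+1 < n)%N by rewrite ltn_subrL n0.
      have [_ /(_ nqn) pw] := lin (k.+1 + q.+1)%N (n - q.+1)%N nq0.
      apply: (@le_trans _ _ (H * S ^+ q.+1 * (e * W (n - q.+1)%N))).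
        apply: (@le_trans _ _ (v (g (k.+1 + q.+1)%N) * M ^+ (k.+1 + q.+1) * (e * W (n - q.+1)%N))).
          by rewrite -mulrA ler_wpM2l ?nanorm_ge0 // mulrA.
        by rewrite ler_wpM2r // mulr_ge0 // ltW.
      apply: (@le_trans _ _ (d * e * r ^+ q.+1 * (e * W (n - q.+1)%N))).
        by rewrite ler_wpM2r ?key // mulr_ge0 // ltW.
      rewrite (_ : _ * _ = d * (e * (e * (r ^+ q.+1 * r ^+ (n - q.+1) * t (n - q.+1)%N)))); last by rewrite /W; ring.
      rewrite -exprD subnKC // ler_pM2l // ler_pM2l //.
      apply: (@le_trans _ _ (r ^+ n * t (n - q.+1)%N)).
        by rewrite ler_piMl // mulr_ge0.
      by rewrite ler_wpM2l // inv_fact_le // -subn1 leq_sub2l.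
  have dn0 : 0 < d * v (n - p)%:R by rewrite mulr_gt0.
  rewrite -(ler_pM2l dn0).
  apply: (@le_trans _ _ (v (D * u n))).
    by rewrite nanormM ler_wpM2r ?nanorm_ge0 //; apply: Dd.
  apply: le_trans bound _; rewrite /W' /t (inv_factS pn) /W /t.
  by rewrite (_ : d * _ = d * v (n - p)%:R * (e * (r ^+ n * inv_fact p n))) //; ring.
have [c /andP[c0 c1] cn] := nanorm_fact_ge v K0.
exists M, (r / c); split; first by rewrite divr_gt0.
have rc1 n : 1 <= (r / c) ^+ n.
  rewrite exprn_ege1 // ler_pdivlMr // mul1r; exact: le_trans r1.
case=> [|n]; first by rewrite mulr1.
apply: le_trans (uW n.+1 isT) _.
apply: (@le_trans _ _ (1 * (r / c) ^+ n.+1)); last first.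
  by rewrite ler_wpM2r // (le_trans _ (rc1 _)).
apply: ler_pM => //; first exact: ltW.
rewrite [(r / c) ^+ _]exprMn /W ler_wpM2l // /t /inv_fact exprVn.
rewrite lef_pV2 ?posrE ?exprn_gt0 ?nanorm_nat_gt0 ?fact_gt0 //.
by apply: le_trans (cn _); apply: ler_wiXn2l; rewrite ?(ltW c0) // leq_subr.
Qed.

End MajorantThm.

(** * Series in one variable *)

Section OneVariable.
Context {K : fieldType}.
Implicit Types (f g h : fps2 K) (P Q N : fmap2 K).

Notation xseries := (homog 0 1 0).

Lemma xseries_coef h i j : xseries h -> (0 < j)%N -> h i j = 0.
Proof. by move=> hx j0; apply: hx; rewrite mul0n mul1n add0n -lt0n. Qed.

Lemma xseries_eq f g : xseries f -> xseries g ->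
  (forall i, f i 0%N = g i 0%N) -> f = g.
Proof.
move=> fx gx fg; apply: fps2P => i [|j]; first exact: fg.
by rewrite !xseries_coef.
Qed.

Lemma ord_ge_xseries h n : xseries h -> (forall i, (i < n)%N -> h i 0%N = 0) -> ord_ge n h.
Proof.
move=> hx h0 i [|j] ij; last by rewrite xseries_coef.
by apply: h0; rewrite addn0 in ij.
Qed.

Lemma xseriesD f g : xseries f -> xseries g -> xseries (f + g).
Proof. by move=> fx gx i j ij; rewrite fps2_coefD fx ?gx ?addr0. Qed.

Lemma xseriesN f : xseries f -> xseries (- f).
Proof. by move=> fx i j ij; rewrite fps2_coefN fx ?oppr0. Qed.

Lemma xseriesZ c f : xseries f -> xseries (c *: f).
Proof. by move=> fx i j ij; rewrite fps2_coefZ fx ?mulr0. Qed.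

Lemma xseriesB f g : xseries f -> xseries g -> xseries (f - g).
Proof. by move=> fx gx; apply: xseriesD => //; apply: xseriesN. Qed.

Lemma xseries_x : xseries (fps2_x : fps2 K).
Proof. by move=> i [|j] //; rewrite /fps2_x andbF. Qed.

Lemma xseries_leading h : xseries h -> h != 0 ->
  exists m, h m 0%N != 0 /\ ord_ge m h.
Proof.
move=> hx h0; have ex : exists m, h m 0%N != 0.
  apply: contrapT => /forallNP all0; case/eqP: h0; apply: xseries_eq => // i.
  by apply: contrapT => /eqP; apply: all0.
exists (ex_minn ex); case: ex_minnP => m hm min; split => //.
apply: ord_ge_xseries => // i im; apply/eqP; apply: contraLR im => /min.
by rewrite -leqNgt.
Qed.

Lemma fps2_comp_xseries h P i j n : xseries h -> fixes_origin P -> (i + j < n)%N ->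
  fps2_comp h P i j = \sum_(k < n) h k 0%N * (P.1 ^+ k) i j.
Proof.
move=> hx P0 ijn; rewrite (fps2_compE h P0 ijn); apply: eq_bigr => k _.
case: n ijn k => // n _ k; rewrite big_ord_recl big1 ?addr0.
  by rewrite /monomial_at expr0 mulr1.
by move=> l _; rewrite xseries_coef // mul0r.
Qed.

Lemma fps2_comp_xseries_eq h P Q : xseries h -> fixes_origin P -> fixes_origin Q ->
  P.1 = Q.1 -> fps2_comp h P = fps2_comp h Q.
Proof.
move=> hx P0 Q0 PQ; apply: fps2P => i j.
by rewrite !(fps2_comp_xseries hx _ (ltnSn _)) // PQ.
Qed.

(** A series with nonzero constant term is invertible. *)
Lemma ord_ge_mul_cancel f h n : f 0%N 0%N != 0 -> ord_ge n (f * h) -> ord_ge n h.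
Proof.
move=> f0 fh; suff H m : (m <= n)%N -> ord_ge m h by apply: H.
elim: m => [|m IH] mn; first by [].
have hm := IH (ltnW mn); move=> i j ij.
have [ijm|ijm] := ltnP (i + j) m; first exact: hm.
have := fh i j (leq_trans ij mn).
rewrite -[f in f * h](subrK (f 0%N 0%N *: 1)) mulrDl fps2_coefD.
rewrite (@ord_geM _ 1 m) ?add0r //; last first.
  by apply: ord_ge1; rewrite fps2_coefB fps2_coefZ fps2_coef1 mulr1 subrr.
by rewrite -scalerAl mul1r fps2_coefZ => /eqP; rewrite mulf_eq0 (negbTE f0) => /eqP.
Qed.

Lemma mul_cancel f h : f 0%N 0%N != 0 -> f * h = 0 -> h = 0.
Proof.
move=> f0 fh; apply: ord_ge_eq0 => n; apply: (ord_ge_mul_cancel f0).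
by rewrite fh.
Qed.

(** The coefficient of [y], as a series in [x] alone. *)
Definition ydiv f : fps2 K := fun i j => if j == 0%N then f i 1%N else 0.

Lemma xseries_ydiv f : xseries (ydiv f).
Proof. by move=> i [|j] //=; rewrite ?muln0. Qed.

Lemma ydivK f : homog 0 1 1 f -> f = fps2_y * ydiv f.
Proof.
move=> fh; apply: fps2P => i j; rewrite coef_yM /ydiv.
by case: j => [|[|j]] //=; apply: fh.
Qed.

Lemma fps2_y_mulI f g : fps2_y * f = fps2_y * g -> f = g.
Proof.
move=> fg; apply: fps2P => i j.
by have := congr1 (fun h : fps2 K => h i j.+1) fg; rewrite !coef_yM.
Qed.

Definition xdiv f : fps2 K := fun i j => f i.+1 j.

Lemma xdivK f : xseries f -> f 0%N 0%N = 0 -> f = fps2_x * xdiv f.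
Proof.
move=> fx f0; apply: fps2P => i j; rewrite coef_xM.
by case: i => [|i] //; case: j => [|j] //; rewrite xseries_coef.
Qed.

(** Writing [P.1] as [x * u] turns the powers of [P.1] into powers of a series with
    nonzero constant term, to which the majorant estimates apply. *)
Lemma coef_comp_xseries_order h P k n : xseries h -> fixes_origin P -> xseries P.1 ->
  ord_ge k h ->
  fps2_comp h P (n + k)%N 0%N =
    \sum_(q < n.+1) h (k + q)%N 0%N * (xdiv P.1 ^+ (k + q)) (n - q)%N 0%N.
Proof.
move=> hx P0 Px hk; rewrite (@fps2_comp_xseries _ _ _ _ (k + n.+1)) //; last by lia.
rewrite big_split_ord /= big1 ?add0r => [|i _]; last first.
  by rewrite hk ?mul0r // addn0.
apply: eq_bigr => q _; rewrite [in LHS](xdivK Px (proj1 P0)) exprMn coef_xXM.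
have qn := ltn_ord q.
by rewrite [(n + k)%N]addnC leq_add2l -ltnS qn subnDl.
Qed.

Lemma coef_compB_xseries h N n : xseries h -> fixes_origin N ->
  (fps2_comp h N - h) n 0%N =
    \sum_(j < n.+1) h j 0%N * (N.1 ^+ j - fps2_x ^+ j) n 0%N.
Proof.
move=> hx N0; rewrite fps2_coefB -[in X in _ - X](fps2_comp_id h).
rewrite !(@fps2_comp_xseries h _ n 0 n.+1) ?addn0 // -sumrB.
by apply: eq_bigr => j _; rewrite -mulrBr.
Qed.

(** Raising to the power [j] multiplies by [j] the first difference between
    a series and [x]: these factors are the only divisors of the parabolic case. *)
Lemma coef_expB_x f k j : ord_ge 2 (f - fps2_x) -> ord_ge k.+1 (f - fps2_x) ->
  ord_ge (j + k) (f ^+ j - fps2_x ^+ j) /\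
  (f ^+ j - fps2_x ^+ j) (j + k)%N 0%N = j%:R * (f - fps2_x) k.+1 0%N.
Proof.
move=> f2 fk; have x1 : ord_ge 1 (fps2_x : fps2 K) by apply: ord_ge1.
have f1 : ord_ge 1 f.
  by rewrite -(subrK fps2_x f); apply: ord_geD x1; apply: ord_ge_le f2.
have fj l : ord_ge (l + k) (f ^+ l - fps2_x ^+ l).
  by rewrite addnC; apply: ord_geBX.
split; first exact: fj.
elim: j => [|j IH]; first by rewrite subrr mul0r.
rewrite (_ : f ^+ j.+1 - _ = fps2_x * (f ^+ j - fps2_x ^+ j)
   + (f - fps2_x) * (f ^+ j - fps2_x ^+ j) + fps2_x ^+ j * (f - fps2_x)); last first.
  by rewrite !exprS; ring.
rewrite !fps2_coefD coef_xM coef_xXM addSn /= IH.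
rewrite (ord_geM f2 (fj j)) ?addr0; last by lia.
rewrite -addnS leq_addr addKn.
by rewrite -natr1 !fps2_coefD; ring.
Qed.

End OneVariable.

(** * Conjugacies between semihyperbolic normal forms *)

Section Semihyperbolic.
Context {R : realType} {K : fieldType} (v : nonarch_norm R K).
Hypothesis K0 : [pchar K] =i pred0.

Notation xseries := (homog 0 1 0).

Lemma geom_bounded_xseries (h : fps2 K) C r : xseries h -> 0 < r ->
  (forall n, v (h n 0%N) <= C * r ^+ n) -> geom_bounded v h.
Proof.
move=> hx r0 hC; exists C, r; split => // i [|j]; first by rewrite addn0.
have C0 : 0 <= C by have := le_trans (nanorm_ge0 v _) (hC 0%N); rewrite mulr1.
by rewrite xseries_coef // nanorm0 mulr_ge0 // exprn_ge0 // ltW.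
Qed.

Lemma geom_bounded_ydiv (f : fps2 K) : geom_bounded v f -> geom_bounded v (ydiv f).
Proof.
move=> [C [s [s0 fC]]]; apply: (@geom_bounded_xseries _ (C * s) s) => //.
  exact: xseries_ydiv.
by move=> n; rewrite -mulrA -exprS -addn1; apply: fC.
Qed.

Lemma xseries_xdiv (f : fps2 K) : xseries f -> xseries (xdiv f).
Proof. by move=> fx i j ij; apply: fx. Qed.

Lemma geom_bounded_large (f : fps2 K) : geom_bounded v f ->
  exists C s, 0 < s /\ forall r, s <= r -> gauss_le v C r f.
Proof.
move=> [C [s [s0 fC]]]; exists C, s; split => // r sr.
by apply: gauss_le_weaken fC => //; apply: ltW.
Qed.

Variables (t : K) (P Q N N' : fmap2 K).
Hypotheses (t0 : t != 0) (P0 : fixes_origin P) (Q0 : fixes_origin Q).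
Hypothesis N0 : fixes_origin N.
Hypothesis PQ : fmap2_comp P Q = fmap2_id.
Hypotheses (gN : geom_bounded2 v N) (gN' : geom_bounded2 v N').
Hypothesis Nl : has_diagonal_linear_part 1 t N.
Hypotheses (Ph : homog2 0 1 P) (Nh : homog2 0 1 N) (Nh' : homog2 0 1 N').
Hypothesis PN : fmap2_comp P N = fmap2_comp N' P.
Hypotheses (p1 : P.1 1%N 0%N != 0) (p2 : P.2 0%N 1%N != 0).

Let u := xdiv P.1.
Let m := ydiv N.2.
Let m' := ydiv N'.2.
Let psi := ydiv P.2.
Let Px : xseries P.1. Proof. by case: Ph. Qed.
Let Nx : xseries N.1. Proof. by case: Nh. Qed.
Let Nx' : xseries N'.1. Proof. by case: Nh'. Qed.
Let P1 : fmap2 K := (P.1, fps2_y).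
Let P10 : fixes_origin P1. Proof. by case: P0. Qed.
Let N1 : fmap2 K := (N.1, fps2_y).
Let N10 : fixes_origin N1. Proof. by case: N0. Qed.
Let mx : xseries m. Proof. exact: xseries_ydiv. Qed.
Let mx' : xseries m'. Proof. exact: xseries_ydiv. Qed.
Let psix : xseries psi. Proof. exact: xseries_ydiv. Qed.
Let NE : N.2 = fps2_y * m. Proof. by apply: ydivK; case: Nh. Qed.
Let NE' : N'.2 = fps2_y * m'. Proof. by apply: ydivK; case: Nh'. Qed.
Let PE : P.2 = fps2_y * psi. Proof. by apply: ydivK; case: Ph. Qed.
Let psi0 : psi 0%N 0%N != 0. Proof. exact: p2. Qed.
Let f2 : ord_ge 2 (N.1 - fps2_x).
Proof. by have [+ _] := proj1 (diagonal_agree _ _ _) Nl; rewrite /= scale1r. Qed.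
Let m0 : m 0%N 0%N = t.
Proof.
have [_ H] := proj1 (diagonal_agree _ _ _) Nl.
by have /subr0_eq := H 0%N 1%N isT; rewrite /= fps2_coefZ /fps2_y mulr1.
Qed.
Let idm : fixes_origin (@fmap2_id K). Proof. by []. Qed.

Lemma comp_x_eq (h : fps2 K) : xseries h -> fps2_comp h N = fps2_comp h N1.
Proof. by move=> hx; apply: fps2_comp_xseries_eq. Qed.

Lemma semiconj_x : fps2_comp P.1 N - P.1 = fps2_comp (N'.1 - fps2_x) P.
Proof.
rewrite fps2_compB fps2_comp_x //; congr (_ - _).
by have := congr1 fst PN.
Qed.

(** The factor [y], common to both sides, has been cancelled. *)
Lemma semiconj_y : m * fps2_comp psi N = psi * fps2_comp m' P.
Proof.
apply: fps2_y_mulI; rewrite !mulrA -NE -PE.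
have := congr1 snd PN; rewrite /= PE NE' !fps2_compM //.
by rewrite !fps2_comp_y // -PE.
Qed.

Lemma comp_right_inverse (h : fps2 K) : fps2_comp (fps2_comp h P) Q = h.
Proof. by rewrite fps2_comp_comp // PQ fps2_comp_id. Qed.

Lemma ord_ge_of_comp (h : fps2 K) n : ord_ge n (fps2_comp h P) -> ord_ge n h.
Proof. by move=> hP; rewrite -[h]comp_right_inverse; apply: ord_ge_comp. Qed.

Lemma conj_linear_part (S : fmap2 K) (c : K) : S.1 = P.1 ->
  agree 2 S (S.1, c *: fps2_y) -> has_diagonal_linear_part (P.1 1%N 0%N) c S.
Proof.
move=> SP [_ S2]; apply/diagonal_agree; split => //; rewrite SP /=.
apply: ord_ge_xseries; first by apply: xseriesB => //; apply: xseriesZ; apply: xseries_x.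
case=> [|[|//]] _; rewrite fps2_coefB fps2_coefZ /fps2_x /=; last by rewrite mulr1 subrr.
by rewrite (proj1 P0) mulr0 subr0.
Qed.

(** The multiplier along the curve of fixed points is a conjugacy invariant. If
    it is not constant, it determines the conjugacy on this curve through an
    analytic equation, and the conjugacy can be taken trivial in the other
    variable. *)
Lemma semihyperbolic_curve : N.1 = fps2_x ->
  exists S c, [/\ fixes_origin S, geom_bounded2 v S,
    c != 0 /\ has_diagonal_linear_part c 1 S & fmap2_comp S N = fmap2_comp N' S].
Proof.
move=> Nid.
have Nid1 : N1 = fmap2_id by rewrite /N1 Nid.
have Nx'E : N'.1 = fps2_x.
  apply/eqP; rewrite -subr_eq0 -[_ - _]comp_right_inverse -semiconj_x.
  by rewrite comp_x_eq // Nid1 fps2_comp_id subrr fps2_comp0.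
have mE : m = fps2_comp m' P.
  apply/eqP; rewrite -subr_eq0; apply/eqP; apply: (mul_cancel psi0).
  by rewrite mulrBr -semiconj_y comp_x_eq // Nid1 fps2_comp_id mulrC subrr.
have [mt|mt] := eqVneq (m - t *: 1) 0.
  have mE' : m' = m.
    have -> : m = t *: 1 by apply/eqP; rewrite -subr_eq0 mt.
    rewrite -[m']comp_right_inverse -mE.
    have -> : m = t *: 1 by apply/eqP; rewrite -subr_eq0 mt.
    by rewrite fps2_compZ fps2_comp1.
  have -> : N' = N.
    by rewrite [N]surjective_pairing [N']surjective_pairing Nid Nx'E NE NE' mE'.
  exists fmap2_id, 1; split => //.
  - by split; [apply: geom_bounded_x|apply: geom_bounded_y].
  - by split; [apply: oner_neq0|apply/diagonal_agree; rewrite diag_map1; split; rewrite subrr].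
  - by rewrite fmap2_comp_idl // fmap2_comp_idr.
have x1 : xseries (1 : fps2 K) by apply: homog1.
have hx : xseries (m - t *: 1) by apply: xseriesB => //; apply: xseriesZ.
have [k0 [hk hord]] := xseries_leading hx mt.
case: k0 hk hord => [|k] hk hord.
  by case/eqP: hk; rewrite fps2_coefB fps2_coefZ fps2_coef1 mulr1 m0 subrr.
have hx' : xseries (m' - t *: 1) by apply: xseriesB => //; apply: xseriesZ.
have hE : fps2_comp (m' - t *: 1) P = m - t *: 1.
  by rewrite fps2_compB fps2_compZ fps2_comp1 // -mE.
have hord' : ord_ge k.+1 (m' - t *: 1) by apply: ord_ge_of_comp; rewrite hE.
have eqn n := coef_comp_xseries_order n hx' P0 Px hord'.
have lead : (m' - t *: 1) k.+1 0%N * u 0%N 0%N ^+ k.+1 = (m - t *: 1) k.+1 0%N.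
  by rewrite -hE; have := eqn 0%N; rewrite add0n big_ord1 addn0 subnn fps2_coefX_row0 => ->.
have hk' : (m' - t *: 1) k.+1 0%N != 0.
  by apply: contraNneq hk => hk'; rewrite -lead hk' mul0r.
have gh : geom_bounded v (m - t *: 1).
  apply: geom_boundedB; first by apply: geom_bounded_ydiv; case: gN.
  by apply: geom_boundedZ; have := geom_bounded_monomial v 0 0; rewrite mulr1.
have gh' : geom_bounded v (m' - t *: 1).
  apply: geom_boundedB; first by apply: geom_bounded_ydiv; case: gN'.
  by apply: geom_boundedZ; have := geom_bounded_monomial v 0 0; rewrite mulr1.
have [C1 [s1 [s10 B1]]] := geom_bounded_large gh.
have [C2 [s2 [s20 B2]]] := geom_bounded_large gh'.
pose s := Num.max s1 s2; have s0 : 0 < s by rewrite lt_max s10.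
have {}B1 : gauss_le v C1 s (m - t *: 1) by apply: B1; rewrite le_max lexx.
have {}B2 : gauss_le v C2 s (m' - t *: 1) by apply: B2; rewrite le_max lexx orbT.
have C10 := gauss_le_ge0 B1; have C20 := gauss_le_ge0 B2.
pose C := C1 * s ^+ k.+1 + C2.
have sX n : 0 <= s ^+ n by rewrite exprn_ge0 // ltW.
have C0 : 0 <= C by rewrite addr_ge0 // mulr_ge0.
pose d := v ((m' - t *: 1) k.+1 0%N * k.+1%:R * u 0%N 0%N ^+ k).
have d0 : 0 < d.
  by rewrite nanorm_gt0 !mulf_neq0 ?expf_neq0 // (proj1 (pcharf0P K) K0).
have [||||||C' [r [r0 ur]]] := @majorant R K v K0 u (fun i => (m' - t *: 1) i 0%N)
    (fun _ _ => 0) (fun n => (m - t *: 1) (n + k.+1)%N 0%N) (fun _ => 0) k 1 C s d _ s0 d0.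
- by [].
- move=> i; apply: le_trans (B2 i 0%N) _; rewrite addn0 ler_wpM2r //.
  by rewrite lerDr mulr_ge0.
- by move=> n a _; rewrite nanorm0 mulr_ge0.
- move=> n; apply: le_trans (B1 _ 0%N) _; rewrite addn0 exprD mulrCA mulrC ler_wpM2r //.
  by rewrite lerDl.
- by move=> n _; rewrite subr0 ler_piMr ?nanorm_nat_le1 // ltW.
- move=> n _; rewrite -hE eqn mul0r add0r [X in _ = X + _]big1 ?add0r // => a _; exact: mul0r.
have gP1 : geom_bounded v P.1.
  rewrite (xdivK Px (proj1 P0)); apply: geom_boundedM; first exact: geom_bounded_x.
  by apply: geom_bounded_xseries ur => //; apply: xseries_xdiv.
exists P1, (P.1 1%N 0%N); split => //.
- by split => //; apply: geom_bounded_y.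
- split=> //; apply: conj_linear_part => //; rewrite scale1r.
  by split; rewrite subrr.
- congr (_, _); rewrite /=.
    by rewrite Nx'E fps2_comp_x //= comp_x_eq // Nid1 fps2_comp_id.
  rewrite fps2_comp_y // NE' fps2_compM // fps2_comp_y //= NE; congr (_ * _).
  by rewrite mE; apply: fps2_comp_xseries_eq.
Qed.

(** When the restriction to the invariant curve is not the identity, every
    conjugacy converges; the divisors are multiples of integers. *)
Lemma semihyperbolic_parabolic : N.1 != fps2_x -> geom_bounded2 v P.
Proof.
move=> Nid.
have fx : xseries (N.1 - fps2_x) by apply: xseriesB => //; apply: xseries_x.
have f0 : N.1 - fps2_x != 0 by rewrite subr_eq0.
have [k0 [fk ford]] := xseries_leading fx f0.
case: k0 fk ford => [|k] fk ford; first by rewrite f2 ?eqxx in fk.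
have k1 : (0 < k)%N by case: k fk {ford} => // fk; rewrite f2 ?eqxx in fk.
pose al := (N.1 - fps2_x) k.+1 0%N.
pose E j := N.1 ^+ j - fps2_x ^+ j.
have Eord j : ord_ge (j + k) (E j) by have [] := coef_expB_x j f2 ford.
have Ecoef j : E j (j + k)%N 0%N = j%:R * al by have [] := coef_expB_x j f2 ford.
have gx : xseries (N'.1 - fps2_x) by apply: xseriesB => //; apply: xseries_x.
have gg : geom_bounded v (N'.1 - fps2_x).
  by apply: geom_boundedB; [case: gN'|apply: geom_bounded_x].
(* As [E j] starts in degree [j + k], the terms with [n < j] vanish. *)
have compB h n : xseries h -> (fps2_comp h N - h) (n + k)%N 0%N =
    \sum_(j < n.+1) h j 0%N * E j (n + k)%N 0%N.
  move=> hx; rewrite coef_compB_xseries //.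
  have -> : ((n + k).+1 = n.+1 + k)%N by lia.
  rewrite big_split_ord /= [X in _ + X]big1 ?addr0 // => i _.
  by rewrite -/(E _) Eord ?mulr0 // addn0; lia.
have compB0 h n : xseries h -> (n <= k)%N -> (fps2_comp h N - h) n 0%N = 0.
  move=> hx nk; rewrite coef_compB_xseries // big1 // => j _.
  case: (posnP j) => [->|j0]; first by rewrite subrr mulr0.
  by rewrite -/(E _) Eord ?mulr0 //; lia.
have compB_ord h : xseries h -> ord_ge k.+1 (fps2_comp h N - h).
  move=> hx; apply: ord_ge_xseries => [|i ik]; last exact: compB0.
  apply: xseriesB => //; rewrite comp_x_eq //; apply: homog_comp => //.
  by move=> i [|[|j]] // _; rewrite /N1 /= /fps2_y; case: (i == 0%N).
have gord : ord_ge k.+1 (N'.1 - fps2_x).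
  by apply: ord_ge_of_comp; rewrite -semiconj_x; apply: compB_ord.
have eqn n : \sum_(q < n.+1) (N'.1 - fps2_x) (k.+1 + q)%N 0%N * (u ^+ (k.+1 + q)) (n - q)%N 0%N
    = n.+1%:R * al * u n 0%N + \sum_(a < n) E a.+1 (n.+1 + k)%N 0%N * u a 0%N.
  rewrite -coef_comp_xseries_order // -semiconj_x -addSnnS compB //.
  rewrite big_ord_recl (proj1 P0) mul0r add0r big_ord_recr /= addrC.
  congr (_ + _); first by rewrite /bump /= add1n Ecoef mulrC.
  by apply: eq_bigr => a _; rewrite /bump /= add1n mulrC.
have lead : al = (N'.1 - fps2_x) k.+1 0%N * u 0%N 0%N ^+ k.
  have := eqn 0%N; rewrite big_ord1 big_ord0 addr0 addn0 subnn fps2_coefX_row0 mul1r.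
  by rewrite exprS mulrCA mulrC => /(mulIf p1).
have [s1 s10 F1] : exists2 s, 0 < s & forall r, s <= r -> gauss_le v r^-1 r N.1.
  apply: gauss_le_tangent; [by case: gN|by case: N0|move=> i j ij].
  have /subr0_eq -> : N.1 i j - fps2_x i j = 0 by rewrite -fps2_coefB f2 ?ij.
  exact: nanorm_nat_le1.
have [C2 [s2 [s20 G2]]] := geom_bounded_large gg.
have bndE s j n : s1 <= s -> (j <= n)%N -> v (E j (n + k)%N 0%N) <= s ^+ k * s ^+ (n - j).
  move=> s1s jn; have s0 : 0 < s by apply: lt_le_trans s1s.
  have : gauss_le v (s^-1 ^+ j) s (E j).
    by apply: gauss_leB; apply: gauss_leX; rewrite ?(ltW s0) //; [apply: F1|apply: gauss_le_x].
  move=> /(_ (n + k)%N 0%N) /le_trans; apply; rewrite addn0.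
  rewrite -{1}(subnKC jn) -addnA exprD mulrA -exprMn mulVf ?gt_eqF // expr1n mul1r.
  by rewrite addnC exprD.
have al0 : 0 < v al by rewrite nanorm_gt0.
have gP1 : geom_bounded v P.1.
  pose s := Num.max s1 s2; have s0 : 0 < s by rewrite lt_max s10.
  have {}G2 : gauss_le v C2 s (N'.1 - fps2_x) by apply: G2; rewrite le_max lexx orbT.
  have C20 := gauss_le_ge0 G2.
  have sX n : 0 <= s ^+ n by rewrite exprn_ge0 // ltW.
  pose C := s ^+ k + C2; have C0 : 0 <= C by rewrite addr_ge0.
  have [|||||C' [r [r0 ur]]] := @majorant R K v K0 u (fun i => (N'.1 - fps2_x) i 0%N)
    (fun n a => E a.+1 (n.+1 + k)%N 0%N) (fun _ => 0) (fun n => n.+1%:R * al) k k C s (v al) k1 s0 al0.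
  - by move=> i; apply: le_trans (G2 i 0%N) _; rewrite addn0 ler_wpM2r // lerDr.
  - move=> n a an; have s1s : s1 <= s by rewrite le_max lexx.
    apply: le_trans (bndE s a.+1 n.+1 s1s (ltnW an)) _.
    by rewrite subSS ler_wpM2r // lerDl.
  - by move=> n; rewrite nanorm0 mulr_ge0.
  - move=> n kn; rewrite -mulrA [k.+1%:R * _]mulrC mulrA -lead -[n.+1%:R * _]mulrC -mulrBr nanormM.
    have -> : k.+1%:R - n.+1%:R = - (n - k)%:R :> K.
      by rewrite (natrB _ (ltnW kn)) -!natr1; ring.
    by rewrite nanormN.
  - by move=> n _; rewrite addr0 eqn.
  rewrite (xdivK Px (proj1 P0)); apply: geom_boundedM; first exact: geom_bounded_x.
  by apply: geom_bounded_xseries ur => //; apply: xseries_xdiv.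
split=> //; rewrite PE; apply: geom_boundedM; first exact: geom_bounded_y.
(* The second component solves a linear equation whose coefficients are known
   to converge, now that the first one does. *)
pose c := fps2_comp m' P - m.
have gm : geom_bounded v m by apply: geom_bounded_ydiv; case: gN.
have gc : geom_bounded v c.
  apply: geom_boundedB => //.
  rewrite (_ : fps2_comp m' P = fps2_comp m' P1); last exact: fps2_comp_xseries_eq.
  apply: geom_bounded_comp => //; last exact: geom_bounded_y.
  by apply: geom_bounded_ydiv; case: gN'.
have ceq : m * (fps2_comp psi N - psi) = psi * c.
  by rewrite mulrBr semiconj_y /c mulrBr [psi * m]mulrC.
have cord : ord_ge k.+1 c.
  apply: (ord_ge_mul_cancel psi0); rewrite -ceq -[k.+1]add0n.
  by apply: ord_geM => //; apply: compB_ord.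
have mE_ord j : ord_ge (j + k) (m * E j) by rewrite -[(j + k)%N]add0n; apply: ord_geM.
have psi_eq n : n%:R * (t * al) * psi n 0%N + \sum_(j < n) ((m * E j) (n + k)%N 0%N - c (n + k - j)%N 0%N) * psi j 0%N = 0.
  have L : (m * (fps2_comp psi N - psi)) (n + k)%N 0%N =
      \sum_(j < n.+1) psi j 0%N * (m * E j) (n + k)%N 0%N.
    rewrite fps2_coefM_row.
    under eq_bigr => i _ do rewrite coef_compB_xseries // mulr_sumr.
    have ext (i : 'I_(n + k).+1) : \sum_(j < ((n + k) - i).+1) m i 0%N * (psi j 0%N * E j (n + k - i)%N 0%N)
        = \sum_(j < n.+1) m i 0%N * (psi j 0%N * E j (n + k - i)%N 0%N).
      pose F j := m i 0%N * (psi j 0%N * E j (n + k - i)%N 0%N).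
      have F0 j : (n + k - i < j + k)%N -> F j = 0.
        by move=> ij; rewrite /F Eord ?addn0 // !mulr0.
      have i_lt := ltn_ord i.
      rewrite -!(big_mkord xpredT F).
      have [le|lt] := leqP (n + k - i).+1 n.+1.
        rewrite [RHS](big_cat_nat (n := (n + k - i).+1)) //= [X in _ + X]big_nat_cond [X in _ + X]big1 ?addr0 //.
        by move=> j /andP[/andP[ij _] _]; apply: F0; clear -ij; lia.
      rewrite [LHS](big_cat_nat (n := n.+1)) //=; last exact: ltnW.
      rewrite [X in _ + X]big_nat_cond [X in _ + X]big1 ?addr0 //.
      by move=> j /andP[/andP[ij _] _]; apply: F0; clear -ij i_lt; lia.
    under eq_bigr => i _ do rewrite ext.
    rewrite exchange_big; apply: eq_bigr => j _ /=.
    rewrite fps2_coefM_row mulr_sumr; apply: eq_bigr => i _.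
    by rewrite mulrCA.
  have Rr : (psi * c) (n + k)%N 0%N = \sum_(j < n) psi j 0%N * c (n + k - j)%N 0%N.
    rewrite fps2_coefM_row -addnS.
    rewrite big_split_ord /= [X in _ + X]big1 ?addr0 // => i _.
    by rewrite cord ?mulr0 // addn0 subnDl ltnS leq_subr.
  have last : (m * E n) (n + k)%N 0%N = n%:R * (t * al).
    rewrite fps2_coefM_row big_ord_recl subn0 Ecoef m0 big1 ?addr0; first by ring.
    move=> i _; rewrite Eord ?mulr0 // addn0 /= /bump /= add1n.
    by rewrite ltn_subrL addn_gt0 k1 orbT.
  have := congr1 (fun h : fps2 K => h (n + k)%N 0%N) ceq.
  rewrite L Rr big_ord_recr /= last => H.
  rewrite (eq_bigr (fun j : 'I_n => psi j 0%N * (m * E j) (n + k)%N 0%N - psi j 0%N * c (n + k - j)%N 0%N)).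
    by rewrite sumrB -H; ring.
  by move=> j _; rewrite mulrBl !(mulrC _ (psi j 0%N)).
have [C3 [s3 [s30 G3]]] := geom_bounded_large gc.
have [C4 [s4 [s40 G4]]] := geom_bounded_large gm.
pose s := Num.max s1 (Num.max s3 s4); have s0 : 0 < s by rewrite lt_max s10.
have s1s : s1 <= s by rewrite le_max lexx.
have {}G3 : gauss_le v C3 s c by apply: G3; rewrite !le_max lexx orbT.
have {}G4 : gauss_le v C4 s m by apply: G4; rewrite !le_max lexx !orbT.
have C30 := gauss_le_ge0 G3; have C40 := gauss_le_ge0 G4.
have sX n : 0 <= s ^+ n by rewrite exprn_ge0 // ltW.
pose C := (C3 + C4) * s ^+ k; have C0 : 0 <= C by rewrite mulr_ge0 // addr_ge0.
(* The recursion is shifted by one, so that its divisor at [n] is [n - 1]: the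
   shift [p] in [majorant] has to be positive. *)
pose A n a : K := if (n, a) is (n'.+1, a'.+1)
  then (m * E a') (n' + k)%N 0%N - c (n' + k - a')%N 0%N else 0.
have d0 : 0 < v (t * al) by rewrite nanorm_gt0 mulf_neq0.
have [||||||C' [r [r0 ur]]] := @majorant R K v K0 (fps2_x * psi) (fun _ => 0) A (fun _ => 0)
    (fun n => (n.-1)%:R * (t * al)) 0 1 C s (v (t * al)) _ s0 d0.
- by [].
- by move=> i; rewrite nanorm0 mulr_ge0.
- move=> [|n] [|a] // an; first by rewrite nanorm0 mulr_ge0.
  rewrite ltnS in an; rewrite subSS /C -mulrA; apply: nanormB_le.
    have : gauss_le v (C4 * s^-1 ^+ a) s (m * E a).
      apply: gauss_leM => //; first exact: ltW.
      by apply: gauss_leB; apply: gauss_leX; rewrite ?(ltW s0) //; [apply: F1|apply: gauss_le_x].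
    move=> /(_ (n + k)%N 0%N) /le_trans; apply; rewrite addn0.
    rewrite -mulrA -{1}(subnKC (ltnW an)) -addnA exprD [s^-1 ^+ a * _]mulrA -exprMn mulVf ?gt_eqF // expr1n mul1r.
    by rewrite addnC exprD ler_wpM2r ?mulr_ge0 // lerDr.
  apply: le_trans (G3 _ 0%N) _; rewrite addn0 -addnBAC ?(ltnW an) // addnC exprD.
  by rewrite ler_wpM2r ?mulr_ge0 // lerDl.
- by move=> n; rewrite nanorm0 mulr_ge0.
- by move=> n n1; rewrite !mul0r sub0r nanormN subn1 mulrC -nanormM.
- move=> [|n] // _; rewrite big1 ?addr0 => [|q _]; last by rewrite mul0r.
  rewrite big_ord_recl /= mul0r add0r coef_xM -[LHS](psi_eq n).
  by congr (_ + _); apply: eq_bigr => a _; rewrite /bump /= !add1n coef_xM.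
apply: (@geom_bounded_xseries _ (C' * r) r) => // n.
by have := ur n.+1; rewrite coef_xM exprS mulrA.
Qed.

Lemma semihyperbolic_conj :
  exists S c1 c2, [/\ fixes_origin S, geom_bounded2 v S,
    [/\ c1 != 0, c2 != 0 & has_diagonal_linear_part c1 c2 S]
    & fmap2_comp S N = fmap2_comp N' S].
Proof.
have [Nid|Nid] := eqVneq N.1 fps2_x.
  have [S [c [S0 gS [c0 Sl] SN]]] := semihyperbolic_curve Nid.
  by exists S, c, 1; split=> //; split=> //; apply: oner_neq0.
exists P, (P.1 1%N 0%N), (P.2 0%N 1%N); split => //; first exact: semihyperbolic_parabolic.
split=> //; apply: conj_linear_part => //; split; rewrite /= ?subrr //.
move=> i j; case: j => [|[|j]].
- by move=> _; rewrite PE fps2_coefB fps2_coefZ !coef_yM /fps2_y andbF mulr0 subr0.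
- rewrite addn1 !ltnS leqn0 => /eqP ->.
  by rewrite fps2_coefB fps2_coefZ /fps2_y mulr1 subrr.
- by rewrite !addnS.
Qed.

End Semihyperbolic.

(** * The groupoid of conjugacies *)

Section Conjugacy.
Context {K : fieldType}.
Implicit Types (P Q F G H S : fmap2 K).

Definition conj_by P F G := fmap2_comp P F = fmap2_comp G P.

Lemma conj_by_comp P S F G H : fixes_origin P -> fixes_origin S ->
  fixes_origin F -> fixes_origin G ->
  conj_by P F G -> conj_by S G H -> conj_by (fmap2_comp S P) F H.
Proof.
move=> P0 S0 F0 G0 PF SG; rewrite /conj_by fmap2_compA // PF.
by rewrite -fmap2_compA // SG fmap2_compA.
Qed.

Lemma conj_by_inverse P Q F G : fixes_origin P -> fixes_origin Q ->
  fixes_origin F -> fixes_origin G ->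
  inverse_fmap2 P Q -> conj_by P F G -> conj_by Q G F.
Proof.
move=> P0 Q0 F0 G0 [PQ QP] PF.
rewrite /conj_by -[fmap2_comp Q G]fmap2_comp_idr -PQ -fmap2_compA //.
rewrite [fmap2_comp (fmap2_comp Q G) P]fmap2_compA // -PF -fmap2_compA // QP.
by rewrite fmap2_comp_idl.
Qed.

Lemma conj_by_inverse_maps P F G F' G' : fixes_origin P -> fixes_origin F ->
  fixes_origin G -> fixes_origin F' -> fixes_origin G' ->
  inverse_fmap2 F F' -> inverse_fmap2 G G' -> conj_by P F G -> conj_by P F' G'.
Proof.
move=> P0 F0 G0 F0' G0' [FF' _] [_ G'G] PF.
rewrite /conj_by -[fmap2_comp P F']fmap2_comp_idl; last exact: fixes_origin_comp.
rewrite -G'G fmap2_compA //; last exact: fixes_origin_comp.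
by rewrite -[fmap2_comp G _]fmap2_compA // -PF fmap2_compA // FF' fmap2_comp_idr.
Qed.

Lemma conj_by_iff P Q F G : fixes_origin P -> fixes_origin Q ->
  fixes_origin F -> fixes_origin G -> inverse_fmap2 P Q ->
  fmap2_comp (fmap2_comp P F) Q = G <-> conj_by P F G.
Proof.
move=> P0 Q0 F0 G0 [PQ QP]; rewrite /conj_by; split=> [<-|->].
  by rewrite fmap2_compA // QP fmap2_comp_idr.
by rewrite fmap2_compA // PQ fmap2_comp_idr.
Qed.

Lemma inverse_fmap2_comp P P' Q Q' : fixes_origin P -> fixes_origin P' ->
  fixes_origin Q -> fixes_origin Q' ->
  inverse_fmap2 P P' -> inverse_fmap2 Q Q' ->
  inverse_fmap2 (fmap2_comp P Q) (fmap2_comp Q' P').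
Proof.
move=> P0 P0' Q0 Q0' [PP' P'P] [QQ' Q'Q].
have QQ0 := fixes_origin_comp Q0' P0'; have PP0 := fixes_origin_comp P0 Q0.
split; rewrite fmap2_compA //.
  by rewrite -[fmap2_comp Q _]fmap2_compA // QQ' fmap2_comp_idl.
by rewrite -[fmap2_comp P' _]fmap2_compA // P'P fmap2_comp_idl.
Qed.

Lemma inverse_fmap2_sym P Q : inverse_fmap2 P Q -> inverse_fmap2 Q P.
Proof. by case. Qed.

(** As [x] and [y] have different weights, neither of them can occur in
    the component that has the weight of the other. *)
Lemma homog2_linear_part a b P : a != b -> fixes_origin P -> homog2 a b P ->
  has_diagonal_linear_part (P.1 1%N 0%N) (P.2 0%N 1%N) P.
Proof.
move=> ab [P10 P20] [P1 P2]; apply/diagonal_agree; split=> /= i j ij;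
  rewrite fps2_coefB fps2_coefZ /fps2_x /fps2_y.
  case: i j ij => [|[|i]] [|[|j]] //= _; rewrite ?P10 ?mulr0 ?mulr1 ?subrr //.
  by rewrite P1 ?subr0 // muln0 muln1 eq_sym.
case: i j ij => [|[|i]] [|[|j]] //= _; rewrite ?P20 ?mulr0 ?mulr1 ?subrr //.
by rewrite P2 ?subr0 // muln0 muln1 addn0.
Qed.

(** The linear part of a composite is the product of the linear parts. *)
Lemma invertible_linear_part p q P Q : fixes_origin P ->
  has_diagonal_linear_part p q P -> fmap2_comp Q P = fmap2_id -> p != 0 /\ q != 0.
Proof.
move=> P0 /diagonal_agree [Pl1 Pl2] QP.
have Q1 (h : fps2 K) i j : (i + j = 1)%N -> ord_ge 1 h ->
    fps2_comp h P i j = p ^+ i * q ^+ j * h i j.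
  move=> ij h1; have /subr0_eq -> : fps2_comp h P i j - fps2_comp h (diag_map p q) i j = 0.
    rewrite -fps2_coefB (ord_geB_comp (m := 1%N) P0 _ Pl1 Pl2 h1) ?ij //.
    exact: fixes_origin_diag.
  exact: fps2_comp_diag.
have [QP1 QP2] : fps2_comp Q.1 P = fps2_x /\ fps2_comp Q.2 P = fps2_y.
  by split; [have := congr1 fst QP|have := congr1 snd QP].
have Q10 : ord_ge 1 Q.1 by apply: ord_ge1; rewrite -(fps2_comp_coef0 _ P0) QP1.
have Q20 : ord_ge 1 Q.2 by apply: ord_ge1; rewrite -(fps2_comp_coef0 _ P0) QP2.
have := Q1 Q.1 1%N 0%N erefl Q10; have := Q1 Q.2 0%N 1%N erefl Q20.
rewrite QP1 QP2 /fps2_x /fps2_y /= !expr0 !expr1 mul1r mulr1 => qE pE.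
split; apply/eqP => z; [move: pE|move: qE]; rewrite z mul0r => /eqP;
  by rewrite oner_eq0.
Qed.

End Conjugacy.

(** * From formal to analytic conjugacies *)

Section Main.
Context {R : realType} {K : fieldType} (v : nonarch_norm R K).
Hypothesis K0 : [pchar K] =i pred0.

(** With positive weights a quasi-homogeneous series is a polynomial. *)
Lemma geom_bounded_homog a b w (f : fps2 K) : (0 < a)%N -> (0 < b)%N ->
  homog a b w f -> geom_bounded v f.
Proof.
move=> a0 b0 fw; pose C := \sum_(i < w.+1) \sum_(j < w.+1) v (f i j).
have C0 : 0 <= C by apply: sumr_ge0 => i _; apply: sumr_ge0 => j _; apply: nanorm_ge0.
exists C, 1; split=> // i j; rewrite expr1n mulr1.
have [ijw|ijw] := eqVneq (a * i + b * j)%N w; last by rewrite fw // nanorm0.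
have iw : (i < w.+1)%N by rewrite ltnS -ijw (leq_trans (leq_pmull i a0)) ?leq_addr.
have jw : (j < w.+1)%N by rewrite ltnS -ijw (leq_trans (leq_pmull j b0)) ?leq_addl.
rewrite /C (bigD1 (Ordinal iw)) //= (bigD1 (Ordinal jw)) //= -addrA lerDl.
by rewrite addr_ge0 // sumr_ge0 // => k _; rewrite ?sumr_ge0 // => *; apply: nanorm_ge0.
Qed.

Lemma geom_bounded2_comp (P Q : fmap2 K) : fixes_origin Q ->
  geom_bounded2 v P -> geom_bounded2 v Q -> geom_bounded2 v (fmap2_comp P Q).
Proof.
by move=> Q0 [P1 P2] [Q1 Q2]; split; apply: geom_bounded_comp.
Qed.

(** With weights [1] and [b >= 2] the conjugacy is itself polynomial; with
    weights [0] and [1] the semihyperbolic analysis applies. *)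
Lemma normal_forms_conj (t : K) a b (P Q N N' : fmap2 K) :
  t != 0 -> v t < 1 -> (a = 1%N /\ (2 <= b)%N) \/ (a = 0%N /\ b = 1%N) ->
  fixes_origin P -> fixes_origin Q -> fixes_origin N -> fixes_origin N' ->
  geom_bounded2 v N -> geom_bounded2 v N' ->
  has_diagonal_linear_part (t ^+ a) (t ^+ b) N ->
  has_diagonal_linear_part (t ^+ a) (t ^+ b) N' ->
  homog2 a b N -> homog2 a b N' -> inverse_fmap2 P Q -> conj_by P N N' ->
  exists S c1 c2, [/\ fixes_origin S, geom_bounded2 v S,
    [/\ c1 != 0, c2 != 0 & has_diagonal_linear_part c1 c2 S] & conj_by S N N'].
Proof.
move=> t0 t1 ab P0 Q0 N0 N0' gN gN' Nl Nl' Nh Nh' [PQ QP] PN.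
have Ph := conj_normal_forms_homog t0 t1 P0 N0 N0' Nl Nl' Nh Nh' PN.
have a_neq_b : a != b by case: ab => [[-> b2]|[-> ->]] //; rewrite neq_ltn b2.
have Pl := homog2_linear_part a_neq_b P0 Ph.
have [p1 p2] := invertible_linear_part P0 Pl QP.
case: ab => [[aE b2]|[aE bE]].
  exists P, (P.1 1%N 0%N), (P.2 0%N 1%N); split => //.
  have a0 : (0 < a)%N by rewrite aE.
  by case: Ph => P1 P2; split; [apply: geom_bounded_homog P1|apply: geom_bounded_homog P2]; rewrite ?(ltnW b2).
rewrite {}aE {}bE expr0 expr1 in Nl Nl' Nh Nh' Ph.
exact: (semihyperbolic_conj K0 t0 P0 Q0 N0 PQ gN gN' Nl Ph Nh Nh' PN p1 p2).
Qed.

(** The formal conjugacy is transported to the normal forms, replaced there by an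
    analytic one, and transported back. *)
Lemma formal_conj_geom_bounded (t : K) a b (P Q F G : fmap2 K) :
  t != 0 -> v t < 1 -> (a = 1%N /\ (2 <= b)%N) \/ (a = 0%N /\ b = 1%N) ->
  fixes_origin P -> fixes_origin Q -> fixes_origin F -> fixes_origin G ->
  geom_bounded2 v F -> geom_bounded2 v G ->
  has_diagonal_linear_part (t ^+ a) (t ^+ b) F ->
  has_diagonal_linear_part (t ^+ a) (t ^+ b) G ->
  inverse_fmap2 P Q -> conj_by P F G ->
  exists S T, [/\ fixes_origin S /\ fixes_origin T, inverse_fmap2 S T,
    geom_bounded2 v S, geom_bounded2 v T & conj_by S F G].
Proof.
move=> t0 t1 ab P0 Q0 F0 G0 gF gG Fl Gl PQ PFG.
have one0 : (1 : K) != 0 by apply: oner_neq0.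
have [A [N [[A0 N0] [gA gN] [Al Nl] Nh AF]]] := analytic_normal_form t0 t1 F0 gF Fl.
have [B [M [[B0 M0] [gB gM] [Bl Ml] Mh BG]]] := analytic_normal_form t0 t1 G0 gG Gl.
have [A' [A0' gA' _ AA']] := geom_bounded_inverse one0 one0 A0 gA Al.
have [B' [B0' gB' _ BB']] := geom_bounded_inverse one0 one0 B0 gB Bl.
have PA0 := fixes_origin_comp P0 A0'; have BPA0 := fixes_origin_comp B0 PA0.
have AQ0 := fixes_origin_comp A0 Q0; have QB0 := fixes_origin_comp Q0 B0'.
have A'N : conj_by A' N F by apply: conj_by_inverse AA' AF.
have PA : conj_by (fmap2_comp P A') N G by apply: conj_by_comp A'N PFG.
have BPA : conj_by (fmap2_comp B (fmap2_comp P A')) N M by apply: conj_by_comp PA BG.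
have inv : inverse_fmap2 (fmap2_comp B (fmap2_comp P A')) (fmap2_comp (fmap2_comp A Q) B').
  apply: inverse_fmap2_comp => //.
  by apply: inverse_fmap2_comp => //; apply: inverse_fmap2_sym.
have [S [c1 [c2 [S0 gS [c10 c20 Sl] SNM]]]] :=
  normal_forms_conj t0 t1 ab BPA0 (fixes_origin_comp AQ0 B0') N0 M0 gN gM Nl Ml Nh Mh inv BPA.
have [S' [S0' gS' _ SS']] := geom_bounded_inverse c10 c20 S0 gS Sl.
have SA0 := fixes_origin_comp S0 A0; have A'S0 := fixes_origin_comp A0' S0'.
exists (fmap2_comp B' (fmap2_comp S A)), (fmap2_comp (fmap2_comp A' S') B); split.
- by split; apply: fixes_origin_comp.
- apply: inverse_fmap2_comp => //; first exact: inverse_fmap2_sym.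
  exact: inverse_fmap2_comp.
- by apply: geom_bounded2_comp => //; apply: geom_bounded2_comp.
- by apply: geom_bounded2_comp => //; apply: geom_bounded2_comp.
- apply: (conj_by_comp (G := M)) => //; last by apply: conj_by_inverse BB' BG.
  exact: conj_by_comp AF SNM.
Qed.

End Main.

Theorem theorem1p1 (R : realType) (K : fieldType) (v : nonarch_norm R K)
  (Kcomplete : complete_norm v) (Knontrivial : nontrivial_norm v)
  (Kchar0 : [pchar K] =i pred0)
  (F G : fmap2 K) (l1 l2 : K)
  (l1_neq0 : l1 != 0) (l2_neq0 : l2 != 0)
  (F0 : fixes_origin F) (G0 : fixes_origin G)
  (Fanalytic : analytic_fmap2 v F) (Ganalytic : analytic_fmap2 v G)
  (Flin : has_diagonal_linear_part l1 l2 F)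
  (Glin : has_diagonal_linear_part l1 l2 G)
  (cases :
    ((exists n : nat, (2 <= n)%N /\ l2 = l1 ^+ n) /\ v l1 != 1 /\ v l2 != 1)
    \/ (l1 = 1 /\ v l2 != 1)) :
  formally_equivalent F G <-> analytically_equivalent v F G.
Proof.
split=> [[P [Q [P0 Q0 PQ PFQ]]]|[P [Q [[P0 Q0] PQ _ _ PFQ]]]]; last first.
  by exists P, Q.
have PFG : conj_by P F G by apply/(conj_by_iff P0 Q0 F0 G0 PQ).
have gF : geom_bounded2 v F by apply/analytic_geom_bounded.
have gG : geom_bounded2 v G by apply/analytic_geom_bounded.
suff [S [T [[S0 T0] ST gS gT SFG]]] : exists S T : fmap2 K,
    [/\ fixes_origin S /\ fixes_origin T, inverse_fmap2 S T,
      geom_bounded2 v S, geom_bounded2 v T & conj_by S F G].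
  exists S, T; split => //; try by apply/analytic_geom_bounded.
  by apply/conj_by_iff.
have [t [a [b [t0 vt ab l1E l2E]]]] : exists (t : K) (a b : nat),
    [/\ t != 0, v t != 1, (a = 1%N /\ (2 <= b)%N) \/ (a = 0%N /\ b = 1%N),
        l1 = t ^+ a & l2 = t ^+ b].
  case: cases => [[[n [n2 l2E]] [v1 _]]|[l1E v2]].
    by exists l1, 1%N, n; split => //; left.
  by exists l2, 0%N, 1%N; split => //; right.
have [F' [F0' gF' F'l FF']] := geom_bounded_inverse l1_neq0 l2_neq0 F0 gF Flin.
have [G' [G0' gG' G'l GG']] := geom_bounded_inverse l1_neq0 l2_neq0 G0 gG Glin.
have [vt1|vt1] := ltP (v t) 1.
  rewrite l1E l2E in Flin Glin.
  exact: (formal_conj_geom_bounded Kchar0 t0 vt1 ab P0 Q0 F0 G0 gF gG Flin Glin PQ PFG).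
(* In the repelling case the inverse maps are attracting. *)
have PFG' := conj_by_inverse_maps P0 F0 G0 F0' G0' FF' GG' PFG.
have ti0 : t^-1 != 0 by rewrite invr_eq0.
have vti : v t^-1 < 1.
  by rewrite nanormV invf_lt1 ?nanorm_gt0 // lt_def vt.
rewrite l1E l2E -!exprVn in F'l G'l.
have [S [T [[S0 T0] ST gS gT SFG']]] :=
  formal_conj_geom_bounded Kchar0 ti0 vti ab P0 Q0 F0' G0' gF' gG' F'l G'l PQ PFG'.
exists S, T; split => //.
by apply: conj_by_inverse_maps SFG' => //; apply: inverse_fmap2_sym.
Qed.
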